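(* Let $n\ge1$, let $A=(A_1,\dots,A_n)\in\mathbb{R}^n$ be a nonnegative vector, and let $D=n+A_1+\cdots+A_n$. For any $f\in H^1_0(\mathbb{R}^n,x^A\,dx)$ with $$\int_{\mathbb{R}^n_A}|f|^2x^A\,dx=1\quad\text{and}\quad\int_{\mathbb{R}^n_A}|f|^2|x|^2x^A\,dx<\infty,$$ the inequality $$\frac{D^2}{4}\le\left(\int_{\mathbb{R}^n_A}|f|^2|x|^2x^A\,dx\right)\left(\int_{\mathbb{R}^n_A}|\nabla f|^2x^A\,dx\right)$$ holds true. Equality holds for $f(x)=\dfrac{e^{-|x|^2/4}}{(2\Pi(A))^{D/4}}$, which satisfies $\int_{\mathbb{R}^n_A}|f|^2x^A\,dx=1$ and $\int_{\mathbb{R}^n_A}|x|^2|f|^2x^A\,dx=D$.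
   Context: Notation: $\mathbb{R}^n_A=\{x\in\mathbb{R}^n: x_i>0\text{ if }A_i>0\}$; $x^A=|x_1|^{A_1}\cdots|x_n|^{A_n}$; $\Pi(A)=\left[2^{-k}\prod_{i=1}^n\Gamma\left(\frac{A_i+1}{2}\right)\right]^{2/D}$ with $k=\sharp\{i:A_i>0\}$ and $\Gamma$ the Gamma function. $H^1_0(\mathbb{R}^n,x^A\,dx)$ is the closure of $C_c^1(\mathbb{R}^n)$ with respect to the norm $\left(\int_{\mathbb{R}^n}(|f|^2+|\nabla f|^2)\,x^A\,dx\right)^{1/2}$. *)

(* Defs.v *)
From HB Require Import structures.
From mathcomp Require Import all_boot all_order all_algebra.
From mathcomp Require Import all_classical all_reals all_analysis.

Set Implicit Arguments.
Unset Strict Implicit.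
Unset Printing Implicit Defensive.

Import Order.TTheory GRing.Theory Num.Theory.
Import numFieldNormedType.Exports.

Local Open Scope classical_set_scope.
Local Open Scope ring_scope.

(** R^n is ['rV[R]_n]. The product of the Borel sigma-algebras of the factors
    is the Borel sigma-algebra of its library topology. *)

Definition measure_rV_display : measure_display.
Proof. exact: default_measure_display. Qed.

Section measurable_rV.
Context {R : realType} {n : nat}.

Definition rV_coord (i : 'I_n) (x : 'rV[R]_n) : R := x 0 i.

Let rV_set0 : g_sigma_preimage rV_coord set0.
Proof. exact: sigma_algebra0. Qed.

Let rV_setC B : g_sigma_preimage rV_coord B -> g_sigma_preimage rV_coord (~` B).
Proof. exact: sigma_algebraC. Qed.

Let rV_bigcup (F : _^nat) : (forall i, g_sigma_preimage rV_coord (F i)) ->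
  g_sigma_preimage rV_coord (\bigcup_i (F i)).
Proof. exact: sigma_algebra_bigcup. Qed.

HB.instance Definition _ := @isMeasurable.Build measure_rV_display
  'rV[R]_n (g_sigma_preimage rV_coord) rV_set0 rV_setC rV_bigcup.

End measurable_rV.

Section measurable_fun_rV.
Context {R : realType}.

Lemma measurable_rV_coord n (i : 'I_n) :
  measurable_fun [set: 'rV[R]_n] (@rV_coord R n i).
Proof.
move=> _ Y mY; rewrite setTI; apply: sub_sigma_algebra => /=.
rewrite -bigcup_seq/=; exists i => /=; first by rewrite mem_index_enum.
by exists Y => //; rewrite setTI.
Qed.

Lemma measurable_fun_rVP d (T : measurableType d) n (f : T -> 'rV[R]_n) :
  measurable_fun [set: T] f <->
  forall i, measurable_fun [set: T] (rV_coord i \o f).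
Proof.
split=> [mf i|mf].
  by apply: measurableT_comp => //; exact: measurable_rV_coord.
move=> _ B mB; rewrite setTI; apply: (mB [set C | measurable (f @^-1` C)]).
split.
  split=> /=; first by rewrite preimage_set0.
    by move=> C mC; rewrite setTD preimage_setC; exact: measurableC.
  by move=> F mF; rewrite preimage_bigcup; exact: bigcupT_measurable.
move=> C; rewrite -bigcup_seq => -[i _ [Y mY <-]] /=.
by rewrite setTI -comp_preimage -[X in measurable X]setTI; exact: mf.
Qed.

Definition rV_cons n (p : R * 'rV[R]_n) : 'rV[R]_n.+1 :=
  \row_i (if unlift ord0 i is Some j then p.2 0 j else p.1).

Lemma rV_cons0 n (p : R * 'rV[R]_n) : rV_cons p 0 ord0 = p.1.
Proof. by rewrite mxE unlift_none. Qed.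

Lemma rV_consS n (p : R * 'rV[R]_n) (j : 'I_n) :
  rV_cons p 0 (lift ord0 j) = p.2 0 j.
Proof. by rewrite mxE liftK. Qed.

Lemma measurable_rV_cons n :
  measurable_fun [set: (R * 'rV[R]_n)%type] (@rV_cons n).
Proof.
apply/measurable_fun_rVP => i; case: (unliftP ord0 i) => [j|] ->.
  rewrite (_ : _ \o _ = rV_coord j \o snd).
    by apply: measurableT_comp; [exact: measurable_rV_coord|exact: measurable_snd].
  by apply/funext => p; rewrite /rV_coord /= rV_consS.
rewrite (_ : _ \o _ = fst); first exact: measurable_fst.
by apply/funext => p; rewrite /rV_coord /= rV_cons0.
Qed.

Section lebesgue_rV_cons.
Context {n : nat} (mu : {sigma_finite_measure set 'rV[R]_n -> \bar R}).

Let nu : set 'rV[R]_n.+1 -> \bar R :=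
  pushforward (@lebesgue_measure R \x mu)%E (@rV_cons n).

HB.instance Definition _ := Measure.copy nu
  (measure_function_pushforward__canonical__measure_function_Measure
    (@lebesgue_measure R \x mu)%E (@measurable_rV_cons n)).

Let sigma_finite_nu : sigma_finite setT nu.
Proof.
have /sigma_finiteP[F [UF ndF oF]] := sigma_finiteT (@lebesgue_measure R).
have /sigma_finiteP[G [UG ndG oG]] := sigma_finiteT mu.
pose H k : set 'rV[R]_n.+1 :=
  [set x | F k (rV_coord ord0 x) /\ G k (\row_i x 0 (lift ord0 i))].
have HE k : @rV_cons n @^-1` H k = F k `*` G k.
  have vE a (v : 'rV[R]_n) : \row_i rV_cons (a, v) 0 (lift ord0 i) = v.
    by apply/rowP => i; rewrite mxE rV_consS.
  by apply/seteqP; split=> -[a v] /=; rewrite /H /= /rV_coord rV_cons0 vE.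
have mtl : measurable_fun [set: 'rV[R]_n.+1]
    (fun x : 'rV[R]_n.+1 => (\row_i x 0 (lift ord0 i) : 'rV[R]_n)).
  apply/measurable_fun_rVP => i.
  rewrite (_ : _ \o _ = rV_coord (lift ord0 i)); first exact: measurable_rV_coord.
  by apply/funext => x; rewrite /rV_coord /= mxE.
exists H => [|k].
  apply/seteqP; split=> // x _.
  have [i _ Fi] : (\bigcup_k F k) (rV_coord ord0 x) by rewrite -UF.
  have [j _ Gj] : (\bigcup_k G k) (\row_i x 0 (lift ord0 i)) by rewrite -UG.
  exists (maxn i j) => //; split.
    by move: Fi; apply/subsetPset/ndF/leq_maxl.
  by move: Gj; apply/subsetPset/ndG/leq_maxr.
have [mF Fy] := oF k; have [mG Gy] := oG k; split.
  apply: measurableI.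
    by rewrite -[X in measurable X]setTI; exact: measurable_rV_coord.
  by rewrite -[X in measurable X]setTI; exact: mtl.
rewrite /nu /pushforward HE product_measure1E//.
by rewrite lte_mul_pinfty// ge0_fin_numE.
Qed.

HB.instance Definition _ :=
  @Measure_isSigmaFinite.Build _ _ _ nu sigma_finite_nu.

Definition lebesgue_rV_cons : {sigma_finite_measure set 'rV[R]_n.+1 -> \bar R} :=
  nu.

End lebesgue_rV_cons.

(** Iterated product measure, transported along R x R^m = R^(m+1); its values
    on boxes, [lebesgue_rV_box] below, determine it. *)
Fixpoint lebesgue_rV (n : nat) : {sigma_finite_measure set 'rV[R]_n -> \bar R} :=
  match n with
  | 0 => \d_ (0 : 'rV[R]_0)
  | m.+1 => lebesgue_rV_cons (lebesgue_rV m)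
  end.

End measurable_fun_rV.
Arguments lebesgue_rV R n : clear implicits.

Lemma lebesgue_rVS (R : realType) (n : nat) :
  lebesgue_rV R n.+1 = pushforward (@lebesgue_measure R \x lebesgue_rV R n)%E
    (@rV_cons R n) :> (set 'rV[R]_n.+1 -> \bar R).
Proof. by []. Qed.

Lemma lebesgue_rV_box (R : realType) (n : nat) (B : 'I_n -> set R) :
  (forall i, measurable (B i)) ->
  lebesgue_rV R n [set x | forall i, B i (x 0 i)] =
    (\prod_(i < n) @lebesgue_measure R (B i))%E.
Proof.
elim: n B => [|n IHn] B mB.
  by rewrite big_ord0 /= diracE mem_set// => -[].
have mbox (C : 'I_n -> set R) : (forall i, measurable (C i)) ->
    measurable [set x : 'rV[R]_n | forall i, C i (x 0 i)].
  move=> mC.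
  rewrite (_ : mkset _ = \bigcap_(i in [set: 'I_n]) (rV_coord i @^-1` C i)).
    apply: fin_bigcap_measurable => // i _.
    by rewrite -[X in measurable X]setTI; exact: measurable_rV_coord.
  by apply/seteqP; split=> [x + i _|x + i]; exact.
rewrite lebesgue_rVS /pushforward.
rewrite (_ : _ @^-1` _ =
    B ord0 `*` [set x : 'rV[R]_n | forall i, B (lift ord0 i) (x 0 i)]).
  rewrite product_measure1E//; last 2 first.
  - exact: mB.
  - by apply: (mbox (fun i => B (lift ord0 i))) => i; exact: mB.
  by rewrite (IHn (fun i => B (lift ord0 i)))// big_ord_recl.
apply/seteqP; split=> [[a v] /= Bav|[a v] /= [Ba Bv] i].
  split; first by have := Bav ord0; rewrite rV_cons0.
  by move=> i; have := Bav (lift ord0 i); rewrite rV_consS.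
by case: (unliftP ord0 i) => [j|] ->; rewrite ?rV_consS ?rV_cons0.
Qed.

Section monomial_weight.
Context {R : realType} {n : nat}.
Implicit Types (A x : 'rV[R]_n) (f phi : 'rV[R]_n -> R) (g : 'rV[R]_n -> 'rV[R]_n).

(** [`|x|] is the sup norm in the library; this is the Euclidean norm. *)
Definition enorm x : R := Num.sqrt (\sum_i x 0 i ^+ 2).

(** x^A; the convention [0 `^ 0 = 1] makes factors with A_i = 0 trivial. *)
Definition mono x A : R := \prod_i `|x 0 i| `^ A 0 i.

Definition posorthant A : set 'rV[R]_n :=
  [set x | forall i, 0 < A 0 i -> 0 < x 0 i].

Definition homdim A : R := n%:R + \sum_i A 0 i.

Definition Gamma_fun (s : R) : R :=
  (\int[lebesgue_measure]_(t in `]0%R, +oo[) (t `^ (s - 1) * expR (- t)))%R.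

Definition Pi_const A : R :=
  (2 ^- #|[pred i | 0 < A 0 i]| *
     \prod_i Gamma_fun ((A 0 i + 1) / 2)) `^ (2 / homdim A).

Definition grad f x : 'rV[R]_n := \row_i 'D_(delta_mx 0 i) f x.

Definition C1c phi : Prop :=
  [/\ forall x, differentiable phi x,
      continuous (grad phi) &
      compact (closure [set x | phi x != 0])].

(** The integral is over all of R^n, not over [posorthant A]. *)
Definition H1norm A f g : \bar R :=
  ((\int[lebesgue_rV R n]_x
     ((`|f x| ^+ 2 + enorm (g x) ^+ 2) * mono x A)%:E) `^ 2^-1)%E.

(** [H10 A f g]: f belongs to the closure of C^1_c for the weighted H^1 norm
    and g is its gradient, i.e. (f, g) is in the closure of the graph of
    [grad] on C^1_c in L^2(x^A dx) x L^2(x^A dx)^n. Such a g is unique almost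
    everywhere: off the null set where some coordinate vanishes, x^A is
    locally bounded below, so there g is the distributional gradient of f. *)
Definition H10 A f g : Prop :=
  [/\ measurable_fun setT f, measurable_fun setT g &
      forall e : R, 0 < e -> exists2 phi, C1c phi &
        (H1norm A (f \- phi)%R (g \- grad phi)%R < e%:E)%E].

Definition gaussian_extremal A x : R :=
  expR (- enorm x ^+ 2 / 4) / (2 * Pi_const A) `^ (homdim A / 4).

End monomial_weight.

(* Main.v *)
Require Import Defs.
From HB Require Import structures.
From mathcomp Require Import all_boot all_order all_algebra.
From mathcomp Require Import all_classical all_reals all_analysis.
From mathcomp Require Import measurable_realfun ring lra.
Import Order.TTheory GRing.Theory Num.Theory.
Import numFieldNormedType.Exports.

Local Open Scope classical_set_scope.
Local Open Scope ring_scope.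

(** The inequality expresses the virial identity: differentiating the dilates
    of psi shows that D times the integral of psi x^A equals the integral of
    (- x.grad psi) x^A, because Lebesgue measure and x^A are homogeneous and the
    domain is a cone. Here the identity is used in an integrated form. For
    t in [0, 1] the weighted integral of h(e^t x) is e^(-tD) times that of h
    ([ge0_integral_weight_dilation]). If psi decreases between x and e x by at
    most the integral of h(e^t x) over t in [0, 1], then Tonelli's theorem gives
    (1 - e^(-D)) int psi <= (1 - e^(-D)) / D int h, which is the virial
    inequality ([virial_le]), provided that the integral of psi is finite.

    For the uncertainty inequality, psi is phi^2 / (1 + eps |x|^2) with phi of
    class C^1. Completing a square bounds - x.grad psi by
    (2 eps + c) |x|^2 phi^2 / (1 + eps |x|^2)^2 + |grad phi|^2 / c, where c > 0 is
    free. The damping factor makes every weight in front of phi^2 bounded, so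
    the estimate passes to limits in the weighted H^1 norm although |x| phi need
    not converge ([damped_virial_approx]). Then eps tends to 0 and
    D <= c M + G / c for every c > 0, with M the second moment of f and G its
    energy. The choice c = D / (2 M) gives D^2 / 4 <= M G
    ([weighted_uncertainty]). The case of infinite G only needs M to be nonzero,
    which holds because the origin is a null set.

    For the Gaussian, the integral of e^(-|x|^2/2) x^A over the cone is a product
    of half-line integrals, which the substitution s = t^2 / 2 turns into Gamma
    values ([gauss_posorthant]); this is the normalization. Its second moment is
    D by the virial identity itself, applied to e^(-|x|^2/2), whose radial
    derivative is - |x|^2 e^(-|x|^2/2) ([virial_eq]), and the energy is a quarter
    of the second moment as grad f = - x f / 2. Finally f is the limit of
    f (1 - d |x|^2)_+^2 as d tends to 0 ([H10_gauss]); the error is controlled by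
    the integral of e^(-|x|^2/4) x^A over the whole space. *)

(** * Dilations of Lebesgue measure on R^n *)

(** s times the image of Lebesgue measure under t |-> s t gives ]a, b] the
    measure s (b / s - a / s) = b - a, hence is Lebesgue measure. *)
Lemma ge0_integral_dilation (R : realType) (s : R) (F : R -> \bar R) :
  0 < s -> measurable_fun [set: R] F -> (forall t, (0 <= F t)%E) ->
  (\int[@lebesgue_measure R]_t F (s * t)%R = s^-1%:E * \int[@lebesgue_measure R]_t F t)%E.
Proof.
move=> s0 mF F0.
have ms : measurable_fun [set: measurableTypeR R]
    ( *%R s : measurableTypeR R -> measurableTypeR R) by exact: measurable_funM.
pose s' : {nonneg R} := NngNum (ltW s0).
pose nu := measure_function_pushforward__canonical__measure_function_Measure
  (@lebesgue_measure R) ms.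
pose m : {measure set (measurableTypeR R) -> \bar R} := mscale s' nu.
have mE A : measurable A -> @lebesgue_measure R A = m A.
  apply: lebesgue_measure_unique.
  move=> _ [[a b]] _ <-.
  transitivity (s%:E *
    @lebesgue_measure R (( *%R s : R -> R) @^-1` `]a, b]%classic))%E => //.
  rewrite (_ : _ @^-1` _ = `]a / s, b / s]%classic).
    rewrite !lebesgue_measure_itv/= !lte_fin ltr_pM2r ?invr_gt0//.
    case: ifPn => ab; last by rewrite mule0.
    by rewrite -!EFinD -EFinM; congr EFin; field; rewrite gt_eqF.
  apply/seteqP; split => x /=; rewrite !in_itv/= ltr_pdivrMr// ler_pdivlMr//;
    by rewrite ![s * _]mulrC.
have -> : (\int[@lebesgue_measure R]_t F t =
    s%:E * \int[@lebesgue_measure R]_t F (s * t)%R)%E.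
  transitivity (\int[m]_t F t)%E.
    by apply: eq_measure_integral => A mA _; exact: mE.
  rewrite ge0_integral_mscale//=; congr (_ * _)%E.
  by rewrite ge0_integral_pushforward.
by rewrite muleA -EFinM mulVf ?mul1e// gt_eqF.
Qed.

Lemma ge0_integral_rVS (R : realType) (n : nat) (F : 'rV[R]_n.+1 -> \bar R) :
  measurable_fun [set: 'rV[R]_n.+1] F -> (forall x, (0 <= F x)%E) ->
  (\int[lebesgue_rV R n.+1]_x F x =
   \int[@lebesgue_measure R]_t \int[lebesgue_rV R n]_v F (rV_cons (t, v)))%E.
Proof.
move=> mF F0.
have mc : measurable_fun [set: (measurableTypeR R * 'rV[R]_n)%type]
    (@rV_cons R n : (measurableTypeR R * 'rV[R]_n)%type -> 'rV[R]_n.+1).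
  exact: measurable_rV_cons.
transitivity
  (\int[(@lebesgue_measure R \x lebesgue_rV R n)%E]_p (F \o @rV_cons R n) p)%E.
  pose P : {measure set (measurableTypeR R * 'rV[R]_n)%type -> \bar R} :=
    (@lebesgue_measure R \x lebesgue_rV R n)%E.
  exact: (@ge0_integral_pushforward _ _ _ _ R _ mc P setT F measurableT mF
    (fun x _ => F0 x)).
exact: (@fubini_tonelli1 _ _ (measurableTypeR R) _ R (@lebesgue_measure R)
  (lebesgue_rV R n) (F \o @rV_cons R n) (measurableT_comp mF mc) (fun p => F0 _)).
Qed.

Lemma measurable_scale_rV (R : realType) (n : nat) (s : R) :
  measurable_fun [set: 'rV[R]_n] (fun x : 'rV[R]_n => s *: x).
Proof.
apply/measurable_fun_rVP => i.
rewrite (_ : _ \o _ = (fun x => s * rV_coord i x)).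
  by apply: measurable_funM => //; exact: measurable_rV_coord.
by apply/funext => x; rewrite /rV_coord /= mxE.
Qed.

Lemma ge0_integral_dilation_rV (R : realType) (n : nat) (s : R)
    (F : 'rV[R]_n -> \bar R) :
  0 < s -> measurable_fun [set: 'rV[R]_n] F -> (forall x, (0 <= F x)%E) ->
  (\int[lebesgue_rV R n]_x F (s *: x)%R =
   (s ^- n)%:E * \int[lebesgue_rV R n]_x F x)%E.
Proof.
move=> s0; elim: n F => [|n IHn] F mF F0.
  rewrite expr0 invr1 mul1e; apply: eq_integral => x _; congr F.
  by apply/rowP => -[].
have mFs : measurable_fun [set: 'rV[R]_n.+1] (fun x => F (s *: x)).
  by apply: (measurableT_comp mF); exact: measurable_scale_rV.
have mFc : measurable_fun setT (F \o @rV_cons R n).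
  by apply: measurableT_comp => //; exact: measurable_rV_cons.
have mG : measurable_fun [set: R]
    (fun t => \int[lebesgue_rV R n]_v F (rV_cons (t, v)))%E.
  exact: (@measurable_fun_fubini_tonelli_F _ _ (measurableTypeR R) _ R
    (lebesgue_rV R n) (F \o @rV_cons R n) mFc (fun p => F0 _)).
rewrite !ge0_integral_rVS//.
transitivity (\int[@lebesgue_measure R]_t ((s ^- n)%:E *
   \int[lebesgue_rV R n]_v F (rV_cons ((s * t)%R, v))))%E.
  apply: eq_integral => t _.
  rewrite -(IHn (fun v => F (rV_cons ((s * t)%R, v))))//; last first.
    by apply: (measurableT_comp mFc); exact: pair1_measurable.
  apply: eq_integral => v _; congr F.
  apply/rowP => i; case: (unliftP ord0 i) => [j|] ->.
    by rewrite mxE !rV_consS mxE.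
  by rewrite mxE !rV_cons0.
rewrite ge0_integralZl//; last 3 first.
- by apply: (measurableT_comp mG); exact: measurable_funM.
- by move=> t _; exact: integral_ge0.
- by rewrite lee_fin invr_ge0 exprn_ge0// ltW.
rewrite (ge0_integral_dilation _ _ _ s0 mG); last by move=> t; exact: integral_ge0.
by rewrite muleA -EFinM; congr (_%:E * _)%E; rewrite exprSr invfM mulrC.
Qed.

Lemma ge0_integral_prod_rV (R : realType) (n : nat) (g : 'I_n -> R -> R) :
  (forall i, measurable_fun [set: R] (g i)) -> (forall i t, 0 <= g i t) ->
  (\int[lebesgue_rV R n]_x (\prod_i g i (x 0%R i))%:E =
   \prod_i \int[@lebesgue_measure R]_t (g i t)%:E)%E.
Proof.
elim: n g => [|n IHn] g mg g0.
  under eq_integral do rewrite big_ord0.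
  rewrite big_ord0 integral_cst// mul1e/=.
  by rewrite diracT.
have mP m (h : 'I_m -> R -> R) : (forall i, measurable_fun [set: R] (h i)) ->
   measurable_fun [set: 'rV[R]_m] (fun x => \prod_i h i (x 0 i)).
  move=> mh; apply: measurable_prod => i _.
  by apply: (measurableT_comp (mh i)); exact: measurable_rV_coord.
rewrite ge0_integral_rVS; last 2 first.
- by apply/measurable_EFinP; exact: mP.
- by move=> x; rewrite lee_fin prodr_ge0.
rewrite big_ord_recl -(IHn (fun i => g (lift ord0 i)))//.
rewrite -ge0_integralZr//; last 3 first.
- by apply/measurable_EFinP; exact: mg.
- by move=> t _; rewrite lee_fin.
- by apply: integral_ge0 => x _; rewrite lee_fin prodr_ge0.
apply: eq_integral => t _.
rewrite -ge0_integralZl//; last 3 first.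
- by apply/measurable_EFinP; apply: (mP _ (fun i => g (lift ord0 i))) => i; exact: mg.
- by move=> x _; rewrite lee_fin prodr_ge0.
- by rewrite lee_fin.
apply: eq_integral => v _; rewrite big_ord_recl EFinM rV_cons0.
by congr (_ * _%:E)%E; apply: eq_bigr => i _; rewrite rV_consS.
Qed.

(** * Integrals along dilation rays *)

Lemma integral_derive01 (R : realType) (u du : R -> R) :
  (forall t : R, is_derive t (1 : R) u (du t)) -> continuous du ->
  (\int[@lebesgue_measure R]_(t in `[0%R, 1%R]) (du t)%:E = (u 1)%:E - (u 0)%:E)%E.
Proof.
move=> u' cdu.
have cu : continuous u.
  move=> t; apply: differentiable_continuous; apply/derivable1_diffP.
  by have [] := u' t.
apply: continuous_FTC2 => //.
- exact: continuous_subspaceT.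
- split.
  + by move=> t _; have [] := u' t.
  + by apply: cvg_at_right_filter; exact: cu.
  + by apply: cvg_at_left_filter; exact: cu.
- by move=> t _; rewrite derive1E; have [] := u' t.
Qed.

Lemma le_integral_derive01 (R : realType) (u du g : R -> R) :
  (forall t : R, is_derive t (1 : R) u (du t)) -> continuous du -> continuous g ->
  (forall t, - du t <= g t) ->
  ((u 0)%:E <= (u 1)%:E + \int[@lebesgue_measure R]_(t in `[0%R, 1%R]) (g t)%:E)%E.
Proof.
move=> u' cdu cg dug.
have cI (k : R -> R) : continuous k ->
    (@lebesgue_measure R).-integrable `[0, 1] (EFin \o k).
  move=> ck; apply: continuous_compact_integrable; first exact: segment_compact.
  exact: continuous_subspaceT.
have cN : continuous (fun t => - du t) by move=> t; apply: continuousN; exact: cdu.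
have -> : ((u 0)%:E = (u 1)%:E +
    \int[@lebesgue_measure R]_(t in `[0%R, 1%R]) (- du t)%:E)%E.
  rewrite (@integral_derive01 _ (fun t => - u t)).
  - by rewrite -EFinB -EFinD; congr EFin; ring.
  - exact: cN.
rewrite leeD2l//; apply: le_integral; [by []|exact: (cI _ cN)|exact: (cI _ cg)|].
by move=> t _; rewrite lee_fin.
Qed.

(** Dilations are written x |-> e^t x, so that the logarithmic derivative of a
    function along them is x.grad, without a factor 1 / t. *)
Definition homogeneous_weight {R : realType} {n : nat} (a : R)
    (w : 'rV[R]_n -> R) : Prop :=
  [/\ measurable_fun setT w, forall x, 0 <= w x &
      forall t x, w (expR t *: x) = expR (t * a) * w x].

Section virial.
Context {R : realType} {n : nat} (a : R) (w : 'rV[R]_n -> R).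
Hypothesis hw : homogeneous_weight a w.
Local Notation mu := (lebesgue_rV R n).
Local Notation D := (n%:R + a).

Lemma ge0_integral_weight_dilation (t : R) (F : 'rV[R]_n -> R) :
  measurable_fun setT F -> (forall x, 0 <= F x) ->
  (\int[mu]_x (F (expR t *: x) * w x)%:E =
   (expR (- (t * D)))%:E * \int[mu]_x (F x * w x)%:E)%E.
Proof.
move=> mF F0; have [mw w0 ws] := hw.
have mFwr : measurable_fun setT (fun x => F x * w x) by exact: measurable_funM.
have mFw : measurable_fun setT (fun x => (F x * w x)%:E) by exact/measurable_EFinP.
have := @ge0_integral_dilation_rV R n (expR t) _ (expR_gt0 t) mFw.
move=> /(_ (fun x => _)) H.
transitivity ((expR (- (t * a)))%:E *
    \int[mu]_x (F (expR t *: x) * w (expR t *: x))%:E)%E.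
  rewrite -ge0_integralZl//; last 2 first.
  - apply/measurable_EFinP.
    exact: (measurableT_comp mFwr (measurable_scale_rV _ _ _)).
  - by move=> x _; rewrite lee_fin mulr_ge0.
  apply: eq_integral => x _; rewrite ws -EFinM; congr EFin.
  by rewrite mulrCA [_ * (_ * w x)]mulrA -expRD addNr expR0 mul1r.
rewrite H; last by move=> x; rewrite lee_fin mulr_ge0.
rewrite muleA -EFinM; congr (_%:E * _)%E.
rewrite -expRM_natl -expRN -expRD; congr expR; ring.
Qed.

Lemma measurable_dilation :
  measurable_fun [set: 'rV[R]_n * R] (fun p => expR p.2 *: p.1).
Proof.
apply/measurable_fun_rVP => i.
rewrite (_ : _ \o _ = (fun p : 'rV[R]_n * R => expR p.2 * rV_coord i p.1)).
  apply: measurable_funM.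
    by apply: measurableT_comp => //; exact: measurable_snd.
  by apply: (measurableT_comp (measurable_rV_coord _)); exact: measurable_fst.
by apply/funext => p; rewrite /rV_coord /= mxE.
Qed.

Lemma integral_expR_itv01 (d : R) : 0 < d ->
  (\int[@lebesgue_measure R]_(t in `[0%R, 1%R]) (expR (- (t * d)))%:E =
   ((1 - expR (- d)) / d)%:E)%E.
Proof.
move=> d0.
have dF (x : R) : is_derive x (1 : R) (fun t : R => - d^-1 * expR (- (t * d)))
    (expR (- (x * d))).
  apply: is_derive_eq.
  by rewrite /GRing.scale/= !(mulr1, mulr0, addr0, add0r); field; rewrite gt_eqF.
rewrite (@integral_derive01 R (fun t => - d^-1 * expR (- (t * d)))
  (fun t => expR (- (t * d)))).
  by rewrite mul1r mul0r oppr0 expR0 -EFinB; congr EFin; field; rewrite gt_eqF.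
move=> t; apply: differentiable_continuous; apply/derivable1_diffP.
exact: ex_derive.
Qed.

(** Tonelli reduces the average over dilations to the integral of e^(-tD) over
    [0, 1]. *)
Lemma integral_dilation_mean (h : 'rV[R]_n -> R) :
  0 < D -> measurable_fun setT h -> (forall x, 0 <= h x) ->
  (\int[mu]_x ((\int[@lebesgue_measure R]_(t in `[0%R, 1%R])
       (h (expR t *: x))%:E) * (w x)%:E) =
   ((1 - expR (- D)) / D)%:E * \int[mu]_x (h x * w x)%:E)%E.
Proof.
move=> D0 mh h0; have [mw w0 ws] := hw.
have mI : measurable (`[0, 1]%classic : set R) by exact: measurable_itv.
pose G (p : 'rV[R]_n * R) := h (expR p.2 *: p.1) * \1_`[0, 1] p.2 * w p.1.
have mG : measurable_fun setT G.
  apply: measurable_funM; last first.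
    by apply: measurableT_comp mw _; exact: measurable_fst.
  apply: measurable_funM.
    exact: (measurableT_comp mh measurable_dilation).
  by apply: (measurableT_comp (measurable_indic mI)); exact: measurable_snd.
have G0 p : 0 <= G p by rewrite !mulr_ge0.
have mhx x : measurable_fun [set: R] (fun t => h (expR t *: x)).
  exact: (measurableT_comp mh
    (measurableT_comp measurable_dilation (pair1_measurable x))).
have H0 : (0 <= \int[mu]_x (h x * w x)%:E)%E.
  by apply: integral_ge0 => x _; rewrite lee_fin mulr_ge0.
transitivity (\int[mu]_x \int[@lebesgue_measure R]_t (G (x, t))%:E)%E.
  apply: eq_integral => x _; rewrite -ge0_integralZr//; last 3 first.
  - by apply/measurable_EFinP; apply: measurable_funTS; exact: mhx.
  - by move=> t _; rewrite lee_fin.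
  - by rewrite lee_fin.
  rewrite integral_mkcond; apply: eq_integral => t _.
  rewrite patchE /G/= indicE; case: ifPn => _; first by rewrite mulr1.
  by rewrite mulr0 mul0r.
transitivity (\int[@lebesgue_measure R]_t \int[mu]_x (G (x, t))%:E)%E.
  apply: (@fubini_tonelli _ _ _ (measurableTypeR R) R mu (@lebesgue_measure R)
    (EFin \o G)); last by move=> p; rewrite lee_fin.
  exact: (measurable_EFinP _ _).2.
rewrite -integral_expR_itv01// -ge0_integralZr//; last first.
  apply/measurable_EFinP; apply: measurable_funTS.
  apply: measurableT_comp => //; apply: measurableT_comp => //.
  exact: measurable_funM.
rewrite [RHS]integral_mkcond; apply: eq_integral => t _.
rewrite patchE /G/= indicE; case: ifPn => _.
  rewrite -ge0_integral_weight_dilation//.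
  by apply: eq_integral => x _; rewrite mulr1.
by apply: integral0_eq => x _; rewrite mulr0 mul0r.
Qed.

Lemma measurable_dilation_integral (h : 'rV[R]_n -> R) :
  measurable_fun setT h -> (forall x, 0 <= h x) ->
  measurable_fun setT (fun x : 'rV[R]_n => \int[@lebesgue_measure R]_(t in `[0%R, 1%R])
    (h (expR t *: x))%:E)%E.
Proof.
move=> mh h0.
have mI : measurable (`[0, 1]%classic : set R) by exact: measurable_itv.
pose G (p : 'rV[R]_n * R) := h (expR p.2 *: p.1) * \1_`[0, 1] p.2.
have mG : measurable_fun setT (EFin \o G).
  apply/measurable_EFinP; apply: measurable_funM.
    exact: (measurableT_comp mh measurable_dilation).
  by apply: (measurableT_comp (measurable_indic mI)); exact: measurable_snd.
have G0 p : (0 <= (EFin \o G) p)%E by rewrite lee_fin mulr_ge0.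
have := @measurable_fun_fubini_tonelli_F _ _ _ (measurableTypeR R) R
  (@lebesgue_measure R) (EFin \o G) mG G0.
apply: eq_measurable_fun => x _; rewrite /fubini_F [RHS]integral_mkcond.
apply: eq_integral => t _.
by rewrite patchE /G/= indicE; case: ifPn; rewrite ?mulr1 ?mulr0.
Qed.

Lemma integral_virial (psi h : 'rV[R]_n -> R) :
  0 < D -> measurable_fun setT psi -> (forall x, 0 <= psi x) ->
  measurable_fun setT h -> (forall x, 0 <= h x) ->
  (\int[mu]_x (((psi (expR 1 *: x))%:E +
     \int[@lebesgue_measure R]_(t in `[0%R, 1%R]) (h (expR t *: x))%:E) *
     (w x)%:E) =
   (expR (- D))%:E * \int[mu]_x (psi x * w x)%:E +
   ((1 - expR (- D)) / D)%:E * \int[mu]_x (h x * w x)%:E)%E.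
Proof.
move=> D0 mpsi psi0 mh h0; have [mw w0 ws] := hw.
have I0 x : (0 <= \int[@lebesgue_measure R]_(t in `[0%R, 1%R]) (h (expR t *: x))%:E)%E.
  by apply: integral_ge0 => t _; rewrite lee_fin.
rewrite -integral_dilation_mean// -[X in expR (- X)]mul1r.
rewrite -ge0_integral_weight_dilation// -ge0_integralD//; last 4 first.
- by move=> x _; rewrite lee_fin mulr_ge0.
- apply/measurable_EFinP; apply: measurable_funM => //.
  exact: (measurableT_comp mpsi (measurable_scale_rV _ _ _)).
- by move=> x _; apply: mule_ge0 => //; rewrite lee_fin.
- apply: emeasurable_funM; last exact/measurable_EFinP.
  exact: measurable_dilation_integral.
by apply: eq_integral => x _; rewrite ge0_muleDl// lee_fin.
Qed.

(** The right-hand side of the ray inequality integrates to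
    e^(-D) N + (1 - e^(-D)) / D H, with N and H the integrals of psi and h.
    Finiteness of N allows e^(-D) N to be moved to the left. *)
Lemma virial_le (psi h : 'rV[R]_n -> R) :
  0 < D -> measurable_fun setT psi -> (forall x, 0 <= psi x) ->
  measurable_fun setT h -> (forall x, 0 <= h x) ->
  (\int[mu]_x (psi x * w x)%:E < +oo)%E ->
  (forall x, (psi x)%:E <= (psi (expR 1 *: x))%:E +
     \int[@lebesgue_measure R]_(t in `[0%R, 1%R]) (h (expR t *: x))%:E)%E ->
  (D%:E * \int[mu]_x (psi x * w x)%:E <= \int[mu]_x (h x * w x)%:E)%E.
Proof.
move=> D0 mpsi psi0 mh h0 Nfin le_psi; have [mw w0 ws] := hw.
have : (\int[mu]_x (psi x * w x)%:E <=
    (expR (- D))%:E * \int[mu]_x (psi x * w x)%:E +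
    ((1 - expR (- D)) / D)%:E * \int[mu]_x (h x * w x)%:E)%E.
  rewrite -integral_virial//; apply: ge0_le_integral => //.
  - by move=> x _; rewrite lee_fin mulr_ge0.
  - by apply/measurable_EFinP; exact: measurable_funM.
  - apply: emeasurable_funM; last exact/measurable_EFinP.
    apply: emeasurable_funD; last exact: measurable_dilation_integral.
    apply/measurable_EFinP.
    exact: (measurableT_comp mpsi (measurable_scale_rV _ _ _)).
  - by move=> x _; rewrite EFinM; apply: lee_wpmul2r; rewrite ?lee_fin.
have : (0 <= \int[mu]_x (psi x * w x)%:E)%E.
  by apply: integral_ge0 => x _; rewrite lee_fin mulr_ge0.
have : (0 <= \int[mu]_x (h x * w x)%:E)%E.
  by apply: integral_ge0 => x _; rewrite lee_fin mulr_ge0.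
case: (\int[mu]_x (h x * w x)%:E)%E => [H| |]//; last by move=> *; rewrite leey.
move: Nfin; case: (\int[mu]_x (psi x * w x)%:E)%E => [N| |]// _ _ _.
rewrite -!EFinM -EFinD !lee_fin => NH.
have eD : 0 < 1 - expR (- D) by rewrite subr_gt0 expR_lt1 oppr_lt0.
rewrite -(ler_pM2l (divr_gt0 eD D0)) mulrA divfK ?lt0r_neq0//.
by rewrite mulrBl mul1r lerBlDl.
Qed.

Lemma virial_eq (psi h : 'rV[R]_n -> R) :
  0 < D -> measurable_fun setT psi -> (forall x, 0 <= psi x) ->
  measurable_fun setT h -> (forall x, 0 <= h x) ->
  (\int[mu]_x (psi x * w x)%:E < +oo)%E ->
  (forall x, (psi x)%:E = (psi (expR 1 *: x))%:E +
     \int[@lebesgue_measure R]_(t in `[0%R, 1%R]) (h (expR t *: x))%:E)%E ->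
  (D%:E * \int[mu]_x (psi x * w x)%:E = \int[mu]_x (h x * w x)%:E)%E.
Proof.
move=> D0 mpsi psi0 mh h0 Nfin eq_psi; have [mw w0 ws] := hw.
have : (\int[mu]_x (psi x * w x)%:E =
    (expR (- D))%:E * \int[mu]_x (psi x * w x)%:E +
    ((1 - expR (- D)) / D)%:E * \int[mu]_x (h x * w x)%:E)%E.
  by rewrite -integral_virial//; apply: eq_integral => x _; rewrite EFinM -eq_psi.
have : (0 <= \int[mu]_x (psi x * w x)%:E)%E.
  by apply: integral_ge0 => x _; rewrite lee_fin mulr_ge0.
have : (0 <= \int[mu]_x (h x * w x)%:E)%E.
  by apply: integral_ge0 => x _; rewrite lee_fin mulr_ge0.
have eD : 0 < 1 - expR (- D) by rewrite subr_gt0 expR_lt1 oppr_lt0.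
move: Nfin; case: (\int[mu]_x (psi x * w x)%:E)%E => [N| |]//.
case: (\int[mu]_x (h x * w x)%:E)%E => [H| |]// _ _ _; last first.
  by rewrite gt0_muley// lte_fin divr_gt0.
rewrite -!EFinM -EFinD => -[NH]; congr EFin.
have NH' : (1 - expR (- D)) * N = (1 - expR (- D)) / D * H.
  by rewrite mulrBl mul1r {1}NH addrAC subrr add0r.
apply: (mulfI (lt0r_neq0 eD)); rewrite mulrCA NH' mulrC mulrAC divfK//.
by rewrite gt_eqF.
Qed.

End virial.

(** * Borel measurability of continuous functions, derivatives along rays *)

Section borel_rV.
Context {R : realType} {n : nat}.

(** The sigma-algebra is generated by the coordinates, and every open set is a
    countable union of boxes with rational centres and radii 1 / (k + 1). *)
Lemma open_measurable_rV (U : set 'rV[R]_n) : open U -> measurable U.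
Proof.
move=> oU.
pose box (p : 'rV[rat]_n * nat) : set 'rV[R]_n :=
  [set x | forall i, `|ratr (p.1 0 i) - x 0 i| < p.2.+1%:R^-1].
have mbox p : measurable (box p).
  rewrite (_ : box p = \bigcap_(i in [set: 'I_n])
    (rV_coord i @^-1` [set t | `|ratr (p.1 0 i) - t| < p.2.+1%:R^-1])).
    apply: fin_bigcap_measurable => // i _.
    rewrite -[X in measurable X]setTI; apply: measurable_rV_coord => //.
    rewrite (_ : [set t | _] = ball (ratr (p.1 0 i) : R) p.2.+1%:R^-1).
      by apply: measurable_ball.
    by [].
  by apply/seteqP; split=> [x + i _|x + i]; exact.
pose B k : set 'rV[R]_n :=
  if unpickle k is Some p then (if `[< box p `<=` U >] then box p else set0) else set0.
rewrite (_ : U = \bigcup_k B k).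
  apply: bigcup_measurable => k _; rewrite /B; case: unpickle => // p.
  by case: ifP.
apply/seteqP; split => [x Ux|x [k _]]; last first.
  by rewrite /B; case: unpickle => // p; case: ifP => // /asboolP; apply.
have /nbhs_ballP[e /= e0 eU] : nbhs x U by exact: open_nbhs_nbhs.
have [k ke] : exists k, k.+1%:R^-1 < e / 2.
  have [k _ kP] := near_infty_natSinv_lt (PosNum (divr_gt0 e0 (ltr0Sn R 1))).
  by exists k; exact: (kP k (leqnn k)).
have /choice[q qP] : forall i, exists q : rat, `|ratr q - x 0 i| < k.+1%:R^-1.
  move=> i; have : x 0 i - k.+1%:R^-1 < x 0 i + k.+1%:R^-1.
    by rewrite ltrBlDr -addrA ltrDl addr_gt0// invr_gt0.
  move=> /rat_in_itvoo[q]; rewrite in_itv/= => /andP[q1 q2]; exists q.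
  by rewrite ltr_distl q1 q2.
(* The radius 1 / (k + 1) is less than half of that of a ball around x in U. *)
pose p := (\row_i q i, k); exists (pickle p) => //.
rewrite /B pickleK; have boxx : box p x by move=> i /=; rewrite mxE.
case: ifP => // /asboolP; case => y yp; apply: eU.
split => // i j; rewrite ord1.
rewrite /ball/= [e]splitr (le_lt_trans _ (ltrD (lt_trans (boxx j) ke) (lt_trans (yp j) ke)))//.
rewrite (_ : x 0 j - y 0 j = - (ratr (p.1 0 j) - x 0 j) + (ratr (p.1 0 j) - y 0 j)); last by ring.
by rewrite (le_trans (ler_normD _ _))// normrN.
Qed.

Lemma continuous_measurable_rV (f : 'rV[R]_n -> R) :
  continuous f -> measurable_fun setT f.
Proof.
move=> /continuousP cf; apply: (measurability _ (RGenOpens.measurableE R)).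
move=> _ [_ [a [b ->] <-]]; rewrite setTI; apply: open_measurable_rV.
exact/cf/interval_open.
Qed.

Lemma continuous_measurable_rV_rV m (f : 'rV[R]_n -> 'rV[R]_m) :
  continuous f -> measurable_fun setT f.
Proof.
move=> cf; apply/measurable_fun_rVP => i; apply: continuous_measurable_rV => x.
exact: (continuous_comp (cf x) (@coord_continuous _ _ _ _ _ _)).
Qed.

End borel_rV.

Section rays.
Context {R : realType} {n : nat}.
Implicit Types (x v : 'rV[R]_n) (f : 'rV[R]_n -> R).

Definition dotr x v : R := \sum_i x 0 i * v 0 i.

Lemma diff_gradE f x v : differentiable f x -> 'd f x v = dotr v (grad f x).
Proof.
move=> df; rewrite {1}(row_sum_delta v) linear_sum; apply: eq_bigr => i _.
by rewrite linearZ/= mxE deriveE.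
Qed.

Lemma is_derive_ray f x (t : R) : (forall y, differentiable f y) ->
  is_derive t (1 : R) (fun s : R => f (expR s *: x))
    (dotr (expR t *: x) (grad f (expR t *: x))).
Proof.
move=> df.
have dc : differentiable (fun s : R => expR s *: x) t.
  apply: differentiableZl; apply/derivable1_diffP; exact: derivable_expR.
have dfc : differentiable (fun s : R => f (expR s *: x)) t.
  exact: (@differentiable_comp _ _ _ _ (fun s : R => expR s *: x) f).
apply: DeriveDef; first exact/derivable1_diffP.
rewrite deriveE//.
rewrite (@diff_comp _ _ _ _ (fun s : R => expR s *: x) f)//= diff_gradE//.
congr (dotr _ _).
rewrite diffZl/=; last by apply/derivable1_diffP; exact: derivable_expR.
rewrite -deriveE; last by apply/derivable1_diffP; exact: derivable_expR.
by rewrite derive_val.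
Qed.

End rays.

(** * The virial inequality for damped squares of C^1 functions *)

Section euclidean.
Context {R : realType} {n : nat}.
Implicit Types (x v : 'rV[R]_n).

Definition sqnorm x : R := \sum_i x 0 i ^+ 2.

Lemma sqnorm_ge0 x : 0 <= sqnorm x.
Proof. by apply: sumr_ge0 => i _; exact: sqr_ge0. Qed.

Lemma sqr_enorm x : enorm x ^+ 2 = sqnorm x.
Proof. by rewrite sqr_sqrtr// sqnorm_ge0. Qed.

Lemma sqnormZ (s : R) x : sqnorm (s *: x) = s ^+ 2 * sqnorm x.
Proof. by rewrite mulr_sumr; apply: eq_bigr => i _; rewrite mxE exprMn. Qed.

Lemma continuous_sumr_rV (I : Type) (r : seq I) (F : I -> 'rV[R]_n -> R) :
  (forall i, continuous (F i)) -> continuous (fun x => \sum_(i <- r) F i x).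
Proof.
move=> cF x; elim: r => [|i r IHr].
  rewrite (_ : (fun _ => _) = cst 0); first exact: cst_continuous.
  by apply/funext => y; rewrite big_nil.
rewrite (_ : (fun _ => _) = (fun y => F i y + \sum_(j <- r) F j y)).
  by apply: continuousD => //; exact: cF.
by apply/funext => y; rewrite big_cons.
Qed.

Lemma continuous_sqr (f : 'rV[R]_n -> R) :
  continuous f -> continuous (fun x => f x ^+ 2).
Proof.
move=> cf x; apply: (@continuous_comp _ _ _ f (fun t : R => t ^+ 2)).
  exact: cf.
exact: exprn_continuous.
Qed.

Lemma continuous_coord_rV m (f : 'rV[R]_n -> 'rV[R]_m) i :
  continuous f -> continuous (fun x => f x 0 i).
Proof. by move=> cf x; exact: (continuous_comp (cf x) (@coord_continuous _ _ _ _ _ _)). Qed.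

Lemma continuous_sqnorm_fun m (f : 'rV[R]_n -> 'rV[R]_m) :
  continuous f -> continuous (fun x => \sum_i f x 0 i ^+ 2).
Proof.
move=> cf; apply: continuous_sumr_rV => i x.
apply: (@continuous_comp _ _ _ (fun y => f y 0 i) (fun t : R => t ^+ 2)).
  exact: continuous_coord_rV.
exact: exprn_continuous.
Qed.

Lemma continuous_sqnorm : continuous sqnorm.
Proof. exact: (@continuous_sqnorm_fun _ id (fun x => cvg_id)). Qed.

Lemma continuous_dotr (f g : 'rV[R]_n -> 'rV[R]_n) :
  continuous f -> continuous g -> continuous (fun x => dotr (f x) (g x)).
Proof.
move=> cf cg; apply: continuous_sumr_rV => i x.
by apply: continuousM; exact: continuous_coord_rV.
Qed.

End euclidean.

Section damping.
Context {R : realType} {n : nat}.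
Variables (eps : R) (eps0 : 0 < eps).
Implicit Types (x : 'rV[R]_n).

(** A bounded substitute for the constant 1: after multiplication by it, the
    second-moment weight |x|^2 becomes bounded, and it is smooth, positive and
    increases to 1 as eps tends to 0. *)
Definition damping x : R := (1 + eps * sqnorm x)^-1.

Let k0 x : 0 < 1 + eps * sqnorm x.
Proof. by rewrite ltr_wpDr// mulr_ge0// ?sqnorm_ge0// ltW. Qed.

Lemma damping_gt0 x : 0 < damping x.
Proof. by rewrite invr_gt0. Qed.

Lemma damping_le1 x : damping x <= 1.
Proof. by rewrite invf_le1// lerDl mulr_ge0// ?sqnorm_ge0// ltW. Qed.

Lemma damping_ge x : 1 - eps * sqnorm x <= damping x.
Proof.
rewrite -(ler_pM2r (k0 x)) mulVf ?gt_eqF//.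
rewrite -subr_ge0 (_ : _ - _ = (eps * sqnorm x) ^+ 2); first exact: sqr_ge0.
by ring.
Qed.

Lemma sqnorm_damping_le x : sqnorm x * damping x ^+ 2 <= eps^-1.
Proof.
have q0 := sqnorm_ge0 x.
rewrite exprVn ler_pdivrMr ?exprn_gt0// -(ler_pM2l eps0) mulrA divff ?gt_eqF//.
rewrite mul1r; set y := eps * sqnorm x.
have y0 : 0 <= y by rewrite mulr_ge0// ltW.
nra.
Qed.

Lemma continuous_damping : continuous damping.
Proof.
move=> x; apply: (@continuousV _ _ (fun y => 1 + eps * sqnorm y)); first by rewrite gt_eqF.
apply: continuousD; first exact: cst_continuous.
by apply: continuousM; [exact: cst_continuous|exact: continuous_sqnorm].
Qed.

End damping.

Section virial_C1.
Context {R : realType} {n : nat}.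
Variables (eps c : R) (eps0 : 0 < eps) (c0 : 0 < c).

(** An upper bound for - x.grad (f^2 damping) when g = grad f, by Young's
    inequality with parameter c. It makes sense for any pair (f, g) and is
    positive, so that it can be compared between f and its approximations. *)
Definition virial_bound (f : 'rV[R]_n -> R) (g : 'rV[R]_n -> 'rV[R]_n) x : R :=
  (2 * eps + c) * (sqnorm x * damping eps x ^+ 2) * f x ^+ 2 + c^-1 * sqnorm (g x).

Lemma continuous_virial_bound (f : 'rV[R]_n -> R) (g : 'rV[R]_n -> 'rV[R]_n) :
  continuous f -> continuous g -> continuous (virial_bound f g).
Proof.
move=> cf cg.
have c1 := continuous_sqr _ cf.
have c2 := continuous_sqr _ (@continuous_damping R n _ eps0).
have c3 := continuous_sqnorm_fun _ _ cg.
have c4 := @continuous_sqnorm R n.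
move=> x.
have c5 := continuousM (c4 x) (c2 x).
have c6 := continuousM (@cst_continuous _ _ (2 * eps + c : R) x) c5.
have c7 := continuousM c6 (c1 x).
have c8 := continuousM (@cst_continuous _ _ (c^-1 : R) x) (c3 x).
exact: (continuousD c7 c8).
Qed.

(** The fundamental theorem of calculus for t |-> psi (e^t x), psi being
    f^2 damping. The difference between [virial_bound] and - x.grad psi is
    c^-1 times the sum of the squares of c damping f x_i + (grad f)_i. *)
Lemma le_damped_ray (f : 'rV[R]_n -> R) x :
  (forall y, differentiable f y) -> continuous (grad f) ->
  ((f x ^+ 2 * damping eps x)%:E <=
   (f (expR 1 *: x) ^+ 2 * damping eps (expR 1 *: x))%:E +
   \int[@lebesgue_measure R]_(t in `[0%R, 1%R])
     (virial_bound f (grad f) (expR t *: x))%:E)%E.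
Proof.
move=> df cg.
pose F y := 2 * f y * dotr y (grad f y) * damping eps y -
   f y ^+ 2 * (2 * eps * sqnorm y * damping eps y ^+ 2).
have cf : continuous f by move=> y; exact: differentiable_continuous.
have cray (k : 'rV[R]_n -> R) : continuous k -> continuous (fun t : R => k (expR t *: x)).
  move=> ck t; apply: (continuous_comp (f := fun s : R => expR s *: x)); last exact: ck.
  apply: differentiable_continuous; apply: differentiableZl.
  by apply/derivable1_diffP; exact: derivable_expR.
have cq := @continuous_sqnorm R n.
have cd := @continuous_damping R n _ eps0.
have cF : continuous F.
  have c1 := continuous_sqr _ cf.
  have c2 := continuous_sqr _ cd.
  have c3 := continuous_dotr _ _ (fun y => @cvg_id _ (nbhs y)) cg.
  move=> y.
  have c4 := continuousM (@cst_continuous _ _ (2 : R) y) (cf y).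
  have c5 := continuousM (continuousM c4 (c3 y)) (cd y).
  have c6 := continuousM (@cst_continuous _ _ (2 * eps : R) y) (cq y).
  exact: (continuousB c5 (continuousM (c1 y) (continuousM c6 (c2 y)))).
have := @le_integral_derive01 R (fun t => f (expR t *: x) ^+ 2 * damping eps (expR t *: x))
  (fun t => F (expR t *: x)) (fun t => virial_bound f (grad f) (expR t *: x)).
rewrite expR0 scale1r; apply; last 3 first.
- exact: cray.
- by apply: cray; exact: continuous_virial_bound.
- move=> t; move: (expR t *: x) => y; rewrite /F /virial_bound.
  rewrite -subr_ge0 [leRHS](_ : _ =
    \sum_i c^-1 * (c * damping eps y * f y * y 0 i + grad f y 0 i) ^+ 2).
    by apply: sumr_ge0 => i _; rewrite mulr_ge0 ?sqr_ge0// invr_ge0 ltW.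
  transitivity (c * damping eps y ^+ 2 * f y ^+ 2 * sqnorm y +
    2 * f y * damping eps y * dotr y (grad f y) + c^-1 * sqnorm (grad f y)).
    by ring.
  rewrite /sqnorm /dotr !mulr_sumr -!big_split/=; apply: eq_bigr => i _.
  by field; rewrite gt_eqF.
move=> t; have ft := @is_derive_ray R n f x t df.
have k0 : 1 + eps * (expR t ^+ 2 * sqnorm x) != 0.
  by rewrite gt_eqF// ltr_wpDr// !mulr_ge0// ?sqnorm_ge0// ltW.
have kE : (fun s : R => damping eps (expR s *: x)) =
    (fun s => (1 + eps * (expR s ^+ 2 * sqnorm x))^-1).
  by apply/funext => s; rewrite /damping sqnormZ.
have dk0 : is_derive t (1 : R) (fun s : R => 1 + eps * (expR s ^+ 2 * sqnorm x))
   (2 * eps * sqnorm (expR t *: x)).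
  by apply: is_derive_eq; rewrite sqnormZ /GRing.scale/=; ring.
have dk : is_derive t (1 : R) (fun s : R => damping eps (expR s *: x))
   (- (2 * eps * sqnorm (expR t *: x) * damping eps (expR t *: x) ^+ 2)).
  have [dk1 dk2] := dk0.
  rewrite kE; apply: DeriveDef; first exact: (@derivableV _ _
    (fun s : R => 1 + eps * (expR s ^+ 2 * sqnorm x))).
  rewrite (@deriveV _ _ (fun s : R => 1 + eps * (expR s ^+ 2 * sqnorm x)))// dk2.
  by rewrite /damping -sqnormZ /GRing.scale/= exprVn; ring.
apply: is_derive_eq.
by rewrite /GRing.scale/= /F; ring.
Qed.

End virial_C1.

(** * The uncertainty inequality for homogeneous weights *)

(** The way limits are taken below: an inequality with an error linear in e,
    valid for all small e > 0, holds without the error. *)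
Lemma ler_addgt0_scale (R : realType) (a b B : R) :
  (forall e, 0 < e -> e <= 1 -> a <= b + e * B) -> a <= b.
Proof.
move=> H; rewrite leNgt; apply/negP => ba.
have B1 : 0 < `|B| + 1 by rewrite ltr_wpDl.
pose e := Num.min 1 ((a - b) / (2 * (`|B| + 1))).
have e0 : 0 < e by rewrite lt_min ltr01/= divr_gt0 ?mulr_gt0// subr_gt0.
have := H e e0; rewrite ge_min lexx/= => /(_ isT).
have eB : e * B <= (a - b) / 2.
  rewrite (le_trans (ler_norm _))// normrM (gtr0_norm e0).
  have : e <= (a - b) / (2 * (`|B| + 1)) by rewrite ge_min lexx orbT.
  rewrite invfM mulrA ler_pdivlMr// => /(le_trans _); apply.
  by rewrite ler_wpM2l ?(ltW e0)// lerDl.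
by move: ba eB; lra.
Qed.

Section weighted_integral.
Context {R : realType} {n : nat} (w : 'rV[R]_n -> R).
Hypotheses (mw : measurable_fun setT w) (w0 : forall x, 0 <= w x).
Local Notation mu := (lebesgue_rV R n).

Implicit Types F G H : 'rV[R]_n -> R.

(** Integrals against the density w. The weight is kept apart from the integrand
    because only the integrands are compared and approximated. *)
Definition wint (F : 'rV[R]_n -> R) : \bar R := (\int[mu]_x (F x * w x)%:E)%E.

Lemma wint_ge0 F : (forall x, 0 <= F x) -> (0 <= wint F)%E.
Proof. by move=> F0; apply: integral_ge0 => x _; rewrite lee_fin mulr_ge0. Qed.

Lemma le_wint F G : measurable_fun setT F -> measurable_fun setT G ->
  (forall x, 0 <= F x) -> (forall x, F x <= G x) -> (wint F <= wint G)%E.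
Proof.
move=> mF mG F0 FG; apply: ge0_le_integral => //.
- by move=> x _; rewrite lee_fin mulr_ge0.
- by apply/measurable_EFinP; exact: measurable_funM.
- by apply/measurable_EFinP; exact: measurable_funM.
- by move=> x _; rewrite lee_fin ler_wpM2r.
Qed.

Lemma wint_linear (b c : R) F G : 0 <= b -> 0 <= c ->
  measurable_fun setT F -> measurable_fun setT G ->
  (forall x, 0 <= F x) -> (forall x, 0 <= G x) ->
  wint (fun x => b * F x + c * G x) = (b%:E * wint F + c%:E * wint G)%E.
Proof.
move=> b0 c0 mF mG F0 G0; rewrite /wint.
have mFw : measurable_fun setT (fun x => F x * w x) by exact: measurable_funM.
have mGw : measurable_fun setT (fun x => G x * w x) by exact: measurable_funM.
rewrite -!ge0_integralZl//; last 4 first.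
- exact/measurable_EFinP.
- by move=> x _; rewrite lee_fin mulr_ge0.
- exact/measurable_EFinP.
- by move=> x _; rewrite lee_fin mulr_ge0.
rewrite -ge0_integralD//.
- by apply: eq_integral => x _; rewrite -!EFinM -EFinD; congr EFin; ring.
- by move=> x _; rewrite lee_fin !mulr_ge0.
- by apply/measurable_EFinP; exact: measurable_funM.
- by move=> x _; rewrite lee_fin !mulr_ge0.
- by apply/measurable_EFinP; exact: measurable_funM.
Qed.

Lemma wintZ (b : R) F : 0 <= b -> measurable_fun setT F -> (forall x, 0 <= F x) ->
  wint (fun x => b * F x) = (b%:E * wint F)%E.
Proof.
move=> b0 mF F0; rewrite /wint -ge0_integralZl//.
- by apply: eq_integral => x _; rewrite -EFinM mulrA.
- by apply/measurable_EFinP; exact: measurable_funM.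
- by move=> x _; rewrite lee_fin mulr_ge0.
Qed.

Lemma le_wint_linear (b c : R) F G H : 0 <= b -> 0 <= c ->
  measurable_fun setT F -> measurable_fun setT G -> measurable_fun setT H ->
  (forall x, 0 <= F x) -> (forall x, 0 <= G x) -> (forall x, 0 <= H x) ->
  (forall x, H x <= b * F x + c * G x) ->
  (wint H <= b%:E * wint F + c%:E * wint G)%E.
Proof.
move=> b0 c0 mF mG mH F0 G0 H0 le_H; rewrite -wint_linear//; apply: le_wint => //.
by apply: measurable_funD; exact: measurable_funM.
Qed.

End weighted_integral.

Section uncertainty.
Context {R : realType} {n : nat} (a : R) (w : 'rV[R]_n -> R).
Hypothesis hw : homogeneous_weight a w.
Local Notation mu := (lebesgue_rV R n).
Local Notation D := (n%:R + a).
Hypothesis D0 : 0 < D.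
Local Notation I := (wint w).

Let mw : measurable_fun setT w. Proof. by have [] := hw. Qed.
Let w0 x : 0 <= w x. Proof. by have [] := hw. Qed.

Lemma measurable_sqnorm_comp m (g : 'rV[R]_m -> 'rV[R]_n) :
  measurable_fun setT g -> measurable_fun setT (fun x => sqnorm (g x)).
Proof.
by move=> mg; apply: (measurableT_comp (continuous_measurable_rV _ continuous_sqnorm)).
Qed.

Lemma measurable_virial_bound (eps c : R) (eps0 : 0 < eps)
    (f : 'rV[R]_n -> R) (g : 'rV[R]_n -> 'rV[R]_n) :
  measurable_fun setT f -> measurable_fun setT g ->
  measurable_fun setT (virial_bound eps c f g).
Proof.
move=> mf mg; apply: measurable_funD; last first.
  by apply: measurable_funM => //; exact: measurable_sqnorm_comp.
apply: measurable_funM; last exact: measurable_funX.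
apply: measurable_funM => //; apply: continuous_measurable_rV => x.
exact: (continuousM (continuous_sqnorm x)
  (continuous_sqr _ (@continuous_damping R n _ eps0) x)).
Qed.

Lemma virial_bound_ge0 (eps c : R) (eps0 : 0 < eps) (c0 : 0 < c)
    (f : 'rV[R]_n -> R) (g : 'rV[R]_n -> 'rV[R]_n) x : 0 <= virial_bound eps c f g x.
Proof.
have q0 := @sqnorm_ge0 R n.
apply: addr_ge0; last by rewrite mulr_ge0// invr_ge0 ltW.
apply: mulr_ge0; last exact: sqr_ge0.
apply: mulr_ge0; last by rewrite mulr_ge0// sqr_ge0.
by rewrite addr_ge0 ?mulr_ge0// ltW.
Qed.

Lemma damped_virial (eps c : R) (f : 'rV[R]_n -> R) : 0 < eps -> 0 < c ->
  (forall x, differentiable f x) -> continuous (grad f) ->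
  (I (fun x => f x ^+ 2)%R < +oo)%E ->
  (D%:E * I (fun x => (f x ^+ 2 * damping eps x)%R) <=
   I (virial_bound eps c f (grad f)))%E.
Proof.
move=> eps0 c0 df cg fin_f.
have cf : continuous f by move=> y; exact: differentiable_continuous.
have mf := continuous_measurable_rV _ cf.
have mf2 : measurable_fun setT (fun x => f x ^+ 2) by exact: measurable_funX.
have mfd : measurable_fun setT (fun x => f x ^+ 2 * damping eps x).
  apply: measurable_funM => //; apply: continuous_measurable_rV.
  exact: continuous_damping.
have fd0 x : 0 <= f x ^+ 2 * damping eps x.
  by rewrite mulr_ge0 ?sqr_ge0// ltW// damping_gt0.
apply: (virial_le _ _ hw) => //.
- apply: measurable_virial_bound => //; exact: continuous_measurable_rV_rV.
- exact: virial_bound_ge0.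
- apply: le_lt_trans fin_f; apply: le_wint => // x.
  by rewrite ler_piMr ?sqr_ge0// damping_le1.
- by move=> x; exact: le_damped_ray.
Qed.

Lemma sqr_le_young (d x y : R) : 0 < d ->
  x ^+ 2 <= (1 + d) * y ^+ 2 + (1 + d^-1) * (x - y) ^+ 2.
Proof.
move=> d0; rewrite -subr_ge0 [leRHS](_ : _ = d^-1 * (d * y - (x - y)) ^+ 2).
  by rewrite mulr_ge0 ?sqr_ge0// invr_ge0 ltW.
by field; rewrite gt_eqF.
Qed.

Lemma sqnorm_le_young (d : R) (x y : 'rV[R]_n) : 0 < d ->
  sqnorm x <= (1 + d) * sqnorm y + (1 + d^-1) * sqnorm (x - y).
Proof.
move=> d0; rewrite /sqnorm !mulr_sumr -big_split/=; apply: ler_sum => i _.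
by rewrite !mxE; exact: sqr_le_young.
Qed.

(** The integrand of the squared H^1 distance between (f, g) and
    (phi, grad phi). *)
Definition h1_gap (f phi : 'rV[R]_n -> R) (g : 'rV[R]_n -> 'rV[R]_n) x : R :=
  (f x - phi x) ^+ 2 + sqnorm (g x - grad phi x).

Lemma measurable_h1_gap (f phi : 'rV[R]_n -> R) (g : 'rV[R]_n -> 'rV[R]_n) :
  measurable_fun setT f -> continuous phi ->
  measurable_fun setT g -> continuous (grad phi) ->
  measurable_fun setT (h1_gap f phi g).
Proof.
move=> mf cp mg cgp; have mp := continuous_measurable_rV _ cp.
have mgp := continuous_measurable_rV_rV _ _ cgp.
apply: measurable_funD; first by apply: measurable_funX; exact: measurable_funB.
apply: measurable_sqnorm_comp; apply/measurable_fun_rVP => i.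
rewrite (_ : _ \o _ = (fun x => g x 0 i - grad phi x 0 i)); last first.
  by apply/funext => x; rewrite /rV_coord/= !mxE.
apply: measurable_funB; first exact: (measurableT_comp (measurable_rV_coord i) mg).
exact: (measurableT_comp (measurable_rV_coord i) mgp).
Qed.

Lemma virial_bound_young (eps c d : R) (f phi : 'rV[R]_n -> R)
    (g : 'rV[R]_n -> 'rV[R]_n) x : 0 < eps -> 0 < c -> 0 < d ->
  virial_bound eps c phi (grad phi) x <= (1 + d) * virial_bound eps c f g x +
    ((1 + d^-1) * ((2 * eps + c) / eps + c^-1)) * h1_gap f phi g x.
Proof.
move=> eps0 c0 d0; rewrite /virial_bound /h1_gap.
have d1 : 0 <= 1 + d^-1 by rewrite addr_ge0// invr_ge0 ltW.
have ec0 : 0 <= 2 * eps + c by rewrite addr_ge0 ?mulr_ge0// ltW.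
have := sqr_le_young _ (phi x) (f x) d0.
have := sqnorm_le_young _ (grad phi x) (g x) d0.
rewrite (_ : phi x - f x = - (f x - phi x)) ?sqrrN; last by ring.
have -> : sqnorm (grad phi x - g x) = sqnorm (g x - grad phi x).
  by rewrite -opprB -scaleN1r sqnormZ sqrrN expr1n mul1r.
have := @sqnorm_damping_le R n _ eps0 x.
have : 0 <= sqnorm x * damping eps x ^+ 2 by rewrite mulr_ge0 ?sqnorm_ge0 ?sqr_ge0.
set Q := sqnorm x * _; set p2 := phi x ^+ 2; set f2 := f x ^+ 2.
have := sqnorm_ge0 (g x - grad phi x); have := sqr_ge0 (f x - phi x).
set X2 := (f x - phi x) ^+ 2; set Y2 := sqnorm (g x - _).
set gp := sqnorm (grad phi x); set gg := sqnorm (g x).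
move=> X0 Y0 Q0 Qe gle fle; clearbody Q p2 f2 X2 Y2 gp gg.
have c1 : 0 <= c^-1 by rewrite invr_ge0 ltW.
have H1 : (2 * eps + c) * Q * p2 <=
    (2 * eps + c) * Q * ((1 + d) * f2 + (1 + d^-1) * X2).
  by rewrite ler_wpM2l// mulr_ge0.
have H2 : c^-1 * gp <= c^-1 * ((1 + d) * gg + (1 + d^-1) * Y2) by rewrite ler_wpM2l.
have H3 : (2 * eps + c) * (1 + d^-1) * X2 * Q <=
    (2 * eps + c) * (1 + d^-1) * X2 * eps^-1.
  by rewrite ler_wpM2l// !mulr_ge0.
have H4 : 0 <= (1 + d^-1) * ((2 * eps + c) / eps) * Y2.
  by rewrite !mulr_ge0// invr_ge0 ltW.
have H5 : 0 <= (1 + d^-1) * c^-1 * X2 by rewrite !mulr_ge0.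
nra.
Qed.

(** Applies [damped_virial] to an approximation phi of f and replaces phi by f
    through (x + y)^2 <= (1 + d) x^2 + (1 + 1 / d) y^2. Since damping <= 1 and
    |x|^2 damping^2 <= 1 / eps, the price is a multiple of the H^1 gap. *)
Lemma damped_virial_approx (eps c d : R) (f phi : 'rV[R]_n -> R)
    (g : 'rV[R]_n -> 'rV[R]_n) : 0 < eps -> 0 < c -> 0 < d ->
  measurable_fun setT f -> measurable_fun setT g ->
  (forall x, differentiable phi x) -> continuous (grad phi) ->
  (I (fun x => f x ^+ 2)%R < +oo)%E -> (I (h1_gap f phi g) < +oo)%E ->
  (D%:E * I (fun x => (f x ^+ 2 * damping eps x)%R) <=
   ((1 + d) ^+ 2)%:E * I (virial_bound eps c f g) +
   (D * (1 + d^-1) + (1 + d) * ((1 + d^-1) * ((2 * eps + c) / eps + c^-1)))%:E *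
     I (h1_gap f phi g))%E.
Proof.
move=> eps0 c0 d0 mf mg dphi cphi ffin gapfin.
have cp : continuous phi by move=> y; exact: differentiable_continuous.
have mp := continuous_measurable_rV _ cp.
have mgp := continuous_measurable_rV_rV _ _ cphi.
have mdamp : measurable_fun setT (@damping R n eps).
  by apply: continuous_measurable_rV; exact: continuous_damping.
have damp0 x : 0 <= @damping R n eps x by rewrite ltW// damping_gt0.
have mgap := measurable_h1_gap f phi g mf cp mg cphi.
have gap0 x : 0 <= h1_gap f phi g x by rewrite addr_ge0 ?sqr_ge0 ?sqnorm_ge0.
have gap1 x : (f x - phi x) ^+ 2 <= h1_gap f phi g x by rewrite lerDl sqnorm_ge0.
have m2 (u : 'rV[R]_n -> R) : measurable_fun setT u -> measurable_fun setT (fun x => u x ^+ 2).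
  by move=> mu2; exact: measurable_funX.
have d1 : 0 <= 1 + d by rewrite addr_ge0// ltW.
have d2 : 0 <= 1 + d^-1 by rewrite addr_ge0// invr_ge0 ltW.
have B0 : 0 <= (2 * eps + c) / eps + c^-1.
  by rewrite addr_ge0 ?divr_ge0 ?invr_ge0 ?addr_ge0 ?mulr_ge0// ltW.
have s0 (u : 'rV[R]_n -> R) x : 0 <= u x ^+ 2 by exact: sqr_ge0.
have sd0 (u : 'rV[R]_n -> R) x : 0 <= u x ^+ 2 * damping eps x by rewrite mulr_ge0.
have A0 : (I (fun x => phi x ^+ 2)%R < +oo)%E.
  apply: (@le_lt_trans _ _ (2%:E * I (fun x => f x ^+ 2)%R + 2%:E * I (h1_gap f phi g))%E).
    apply: le_wint_linear => //; [exact: m2|exact: m2|].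
    move=> x; apply: (le_trans (sqr_le_young _ (phi x) (f x) ltr01)).
    rewrite invr1 (_ : (phi x - f x) ^+ 2 = (f x - phi x) ^+ 2); last by ring.
    by have := gap1 x; lra.
  by rewrite lte_add_pinfty// lte_mul_pinfty// ?lee_fin// fin_numE.
have A1 : (I (fun x => f x ^+ 2 * damping eps x)%R <=
    (1 + d)%:E * I (fun x => phi x ^+ 2 * damping eps x)%R +
    (1 + d^-1)%:E * I (h1_gap f phi g))%E.
  apply: le_wint_linear => //.
  - by apply: measurable_funM => //; exact: m2.
  - by apply: measurable_funM => //; exact: m2.
  - move=> x; rewrite mulrA.
    have := sqr_le_young _ (f x) (phi x) d0; have := gap1 x; have := damp0 x.
    have := @damping_le1 R n _ eps0 x; have := s0 (fun x => f x - phi x) x => /=.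
    move: (damping eps x) => e s1 e1 e0 g1 /(ler_wpM2r e0) /le_trans; apply.
    rewrite mulrDl lerD2l -mulrA ler_wpM2l// (le_trans _ g1)//.
    by rewrite ler_piMr.
have A2 := @damped_virial eps c phi eps0 c0 dphi cphi A0.
have A3 : (I (virial_bound eps c phi (grad phi)) <=
    (1 + d)%:E * I (virial_bound eps c f g) +
    ((1 + d^-1) * ((2 * eps + c) / eps + c^-1))%:E * I (h1_gap f phi g))%E.
  apply: le_wint_linear => //.
  - exact: mulr_ge0.
  - exact: measurable_virial_bound.
  - exact: measurable_virial_bound.
  - exact: virial_bound_ge0.
  - exact: virial_bound_ge0.
  - by move=> x; exact: virial_bound_young.
set B := (2 * eps + c) / eps + c^-1 in B0 A3 *.
move: A1 A2 A3 gapfin.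
have := @wint_ge0 _ _ w w0 _ (sd0 f).
have := @wint_ge0 _ _ w w0 _ (sd0 phi).
have := @wint_ge0 _ _ w w0 _ gap0.
have := @wint_ge0 _ _ w w0 _ (virial_bound_ge0 _ _ eps0 c0 f g).
have := @wint_ge0 _ _ w w0 _ (virial_bound_ge0 _ _ eps0 c0 phi (grad phi)).
case: (I (h1_gap f phi g)) => [X| |]//.
case: (I (virial_bound eps c f g)) => [V| |]//; last first.
  by move=> *; rewrite gt0_muley ?lte_fin ?exprn_gt0 ?addye ?leey// ltr_wpDl.
case: (I (virial_bound eps c phi (grad phi))) => [V'| |]//.
case: (I (fun x => phi x ^+ 2 * damping eps x)%R) => [N'| |]//; last first.
  by move=> ? ? ? ? ? A1; rewrite gt0_muley ?lte_fin.
case: (I (fun x => f x ^+ 2 * damping eps x)%R) => [N| |]//.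
rewrite -!EFinM -!EFinD !lee_fin => V'0 V0 X0 N'0 N0 A1 A2 A3 _.
have A1' := ler_wpM2l (ltW D0) A1.
have A2' := ler_wpM2l d1 A2.
have A3' := ler_wpM2l d1 A3.
nra.
Qed.

End uncertainty.

Section uncertainty_principle_bounds.
Context {R : realType} {n : nat} (a : R) (w : 'rV[R]_n -> R).
Hypothesis hw : homogeneous_weight a w.
Local Notation D := (n%:R + a).
Hypothesis D0 : 0 < D.
Local Notation I := (wint w).

Variables (f : 'rV[R]_n -> R) (g : 'rV[R]_n -> 'rV[R]_n) (M G : R).
Hypotheses (mf : measurable_fun setT f) (mg : measurable_fun setT g).
Hypothesis approx_f : forall e : R, 0 < e -> exists phi,
  [/\ forall x, differentiable phi x, continuous (grad phi) &
      (I (h1_gap f phi g) <= e%:E)%E].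
Hypothesis If : I (fun x => f x ^+ 2) = 1%E.
Hypothesis IM : I (fun x => sqnorm x * f x ^+ 2) = M%:E.
Hypothesis IG : I (fun x => sqnorm (g x)) = G%:E.

Let mw : measurable_fun setT w. Proof. by have [] := hw. Qed.
Let w0 x : 0 <= w x. Proof. by have [] := hw. Qed.

(** The gap is arbitrarily small, so its contribution vanishes. What remains is
    expressed by the undamped moments using 1 - eps |x|^2 <= damping <= 1. *)
Lemma damped_uncertainty (c eps : R) : 0 < c -> 0 < eps ->
  D <= D * (eps * M) + (1 + eps) ^+ 2 * ((2 * eps + c) * M + c^-1 * G).
Proof.
move=> c0 eps0.
have mf2 : measurable_fun setT (fun x => f x ^+ 2) by exact: measurable_funX.
have mq : measurable_fun setT (@sqnorm R n).
  exact: continuous_measurable_rV _ continuous_sqnorm.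
have mqf : measurable_fun setT (fun x => sqnorm x * f x ^+ 2).
  exact: measurable_funM.
have mgg : measurable_fun setT (fun x => sqnorm (g x)).
  exact: measurable_sqnorm_comp.
have mdamp : measurable_fun setT (@damping R n eps).
  by apply: continuous_measurable_rV; exact: continuous_damping.
have damp0 x : 0 <= @damping R n eps x by rewrite ltW// damping_gt0.
have q0 := @sqnorm_ge0 R n.
have f20 x : 0 <= f x ^+ 2 by exact: sqr_ge0.
have e1 : (1 <= I (fun x => f x ^+ 2 * damping eps x)%R + (eps * M)%:E)%E.
  rewrite -If EFinM -IM -[X in (X + _)%E]mul1e.
  apply: le_wint_linear => //; [exact: ltW|exact: measurable_funM| | |].
  - by move=> x; rewrite mulr_ge0.
  - by move=> x; rewrite mulr_ge0.
  - move=> x; have := @damping_ge R n _ eps0 x.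
    move=> /(ler_wpM2r (f20 x)); lra.
have e2 : (I (virial_bound eps c f g) <= ((2 * eps + c) * M + c^-1 * G)%:E)%E.
  rewrite EFinD !EFinM -IM -IG; apply: le_wint_linear => //.
  - by rewrite addr_ge0 ?mulr_ge0// ltW.
  - by rewrite invr_ge0 ltW.
  - exact: measurable_virial_bound.
  - by move=> x; rewrite mulr_ge0.
  - exact: virial_bound_ge0.
  - move=> x; rewrite /virial_bound lerD2r -(mulrA (2 * eps + c)).
    apply: ler_wpM2l; first by rewrite addr_ge0 ?mulr_ge0// ltW.
    apply: ler_wpM2r => //; apply: ler_piMr => //.
    by rewrite expr_le1//; exact: damping_le1.
pose K := (D * (1 + eps^-1) + (1 + eps) * ((1 + eps^-1) * ((2 * eps + c) / eps + c^-1))).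
apply: (@ler_addgt0_scale _ _ _ K) => e e0 _.
have [phi [dphi cphi gap]] := approx_f e e0.
have gapfin := le_lt_trans gap (ltry e).
have ffin : (I (fun x => f x ^+ 2)%R < +oo)%E by rewrite If ltry.
have := @damped_virial_approx R n a w hw D0 eps c eps f phi g eps0 c0 eps0 mf mg
  dphi cphi ffin gapfin.
rewrite -/K => e3.
have K0 : 0 <= K.
  have i0 : 0 <= eps^-1 by rewrite invr_ge0 ltW.
  have j0 : 0 <= (2 * eps + c) / eps + c^-1.
    by rewrite addr_ge0 ?divr_ge0 ?invr_ge0 ?addr_ge0 ?mulr_ge0// ltW.
  apply: addr_ge0; apply: mulr_ge0; [exact: ltW|exact: addr_ge0| |].
    by rewrite addr_ge0// ltW.
  by apply: mulr_ge0 => //; exact: addr_ge0.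
have K1 : (0 <= ((1 + eps) ^+ 2)%:E :> \bar R)%E by rewrite lee_fin sqr_ge0.
have K2 : (0 <= K%:E)%E by [].
have e4 := le_trans e3 (leeD (lee_wpmul2l K1 e2) (lee_wpmul2l K2 gap)).
have := @wint_ge0 _ _ w w0 (fun x => f x ^+ 2 * damping eps x)
  (fun x => mulr_ge0 (f20 x) (damp0 x)).
move: e1 e4; case: (I (fun x => f x ^+ 2 * damping eps x)%R) => [N| |]//; last first.
  by rewrite gt0_muley.
rewrite -!EFinM -!EFinD !lee_fin => e1 e4 _.
have e1' := ler_wpM2l (ltW D0) e1.
move: e1' e4; rewrite mulr1 mulrDr (mulrC K).
set A1 := D * N; set A2 := D * (eps * M); set A3 := _ * (_ + _); lra.
Qed.

(** Letting eps tend to 0 gives D <= c M + G / c for all c > 0. This forces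
    M > 0, and c = D / (2 M) balances the two terms. *)
Lemma weighted_uncertainty : D ^+ 2 / 4 <= M * G /\ 0 < M.
Proof.
have M0 : 0 <= M.
  rewrite -lee_fin -IM; apply: wint_ge0 => // x.
  by rewrite mulr_ge0 ?sqnorm_ge0 ?sqr_ge0.
have G0 : 0 <= G.
  by rewrite -lee_fin -IG; apply: wint_ge0 => // x; exact: sqnorm_ge0.
have key c : 0 < c -> D <= c * M + c^-1 * G.
  move=> c0; have ci : 0 <= c^-1 * G by rewrite mulr_ge0// invr_ge0 ltW.
  have cM : 0 <= c * M by rewrite mulr_ge0// ltW.
  apply: (@ler_addgt0_scale _ _ _
    (D * M + 2 * M + 3 * (c * M + c^-1 * G + 2 * M))) => e e0 e1.
  apply: (le_trans (damped_uncertainty _ _ c0 e0)).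
  have h1 : (1 + e) ^+ 2 <= 1 + 3 * e by nra.
  set X := c * M + c^-1 * G + 2 * M.
  have X0 : 0 <= X by apply: addr_ge0; [exact: addr_ge0|exact: mulr_ge0].
  have h2 : (2 * e + c) * M + c^-1 * G <= X by rewrite /X; nra.
  have h3 : (1 + e) ^+ 2 * ((2 * e + c) * M + c^-1 * G) <=
     (1 + 3 * e) * ((2 * e + c) * M + c^-1 * G).
    by rewrite ler_wpM2r// addr_ge0// mulr_ge0// addr_ge0// ?mulr_ge0// ltW.
  have h4 : 3 * e * ((2 * e + c) * M + c^-1 * G) <= 3 * e * X.
    by rewrite ler_wpM2l// mulr_ge0// ltW.
  by nra.
have Mgt0 : 0 < M.
  rewrite lt_neqAle M0 andbT eq_sym; apply/eqP => M00.
  (* If M = 0, then D <= G / c for all c, which fails for c = (G + 1) / D. *)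
  have c0 : 0 < (G + 1) / D by rewrite divr_gt0// ltr_wpDl.
  have := key _ c0; rewrite M00 mulr0 add0r invf_div mulrAC ler_pdivlMr ?ltr_wpDl//.
  by rewrite ler_pM2l//; lra.
split => //.
have c0 : 0 < D / (2 * M) by rewrite divr_gt0// mulr_gt0.
have := key _ c0; rewrite invf_div.
have -> : D / (2 * M) * M = D / 2 by field; rewrite gt_eqF.
move=> /(ler_wpM2l (ltW D0)).
have -> : D * (D / 2 + 2 * M / D * G) = D ^+ 2 / 2 + 2 * (M * G).
  by field; rewrite gt_eqF.
by rewrite -expr2; lra.
Qed.

End uncertainty_principle_bounds.

(** * Gaussian moments on the half-line and the Gamma function *)

Section half_line.
Context {R : realType}.
Local Notation leb := (@lebesgue_measure R).

Lemma bigcup_itv_inv : \bigcup_k `[k.+1%:R^-1, k.+1%:R]%classic = `]0, +oo[%classic :> set R.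
Proof.
apply/seteqP; split => [x [k _]/=|x/=]; rewrite !in_itv/=.
  by move=> /andP[kx _]; rewrite andbT (lt_le_trans _ kx)// invr_gt0.
rewrite andbT => x0.
pose k := Num.bound (x + x^-1); exists k => //=; rewrite in_itv/=.
have xi0 : 0 < x^-1 by rewrite invr_gt0.
have : x + x^-1 <= k.+1%:R.
  by rewrite (le_trans (ltW (archi_boundP _)))// ?addr_ge0 ?ltW// ltr_nat.
move=> h; apply/andP; split; last by rewrite (le_trans _ h)// lerDl ltW.
by rewrite invf_ple ?posrE// (le_trans _ h)// lerDr ltW.
Qed.

(** G may be singular at 0 and the derivative t of t^2 / 2 is unbounded, so the
    substitution is made on the segments [1 / (k + 1), k + 1], which exhaust the
    half-line. *)
Lemma ge0_integral_half_sqr (G : R -> R) :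
  (forall s, 0 < s -> 0 <= G s) ->
  {in `]0, +oo[, continuous G} ->
  (\int[leb]_(s in `]0%R, +oo[) (G s)%:E =
   \int[leb]_(t in `]0%R, +oo[) (G (t ^+ 2 / 2) * t)%:E)%E.
Proof.
move=> G0 cG.
pose F (t : R) : R := t ^+ 2 / 2.
have dF (t : R) : is_derive t (1 : R) F t.
  by apply: is_derive_eq; rewrite /GRing.scale/=; field.
have F'E : (F^`())%classic = id by apply/funext => t; rewrite derive1E derive_val.
have cF : continuous F.
  by move=> t; apply: differentiable_continuous; apply/derivable1_diffP.
pose U (k : nat) : set R := `[k.+1%:R^-1, k.+1%:R]%classic.
pose V (k : nat) : set R := `[F k.+1%:R^-1, F k.+1%:R]%classic.
have ak (k : nat) : 0 < k.+1%:R^-1 :> R by rewrite invr_gt0.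
have kk (k : nat) : k.+1%:R^-1 <= k.+1%:R :> R.
  by rewrite (@le_trans _ _ 1)// ?invf_le1 ?ler1n// ltr0n.
have Fhomo (x y : R) : 0 <= x -> x < y -> F x < F y.
  by move=> x0 xy; rewrite ltr_pM2r ?invr_gt0// ltr_pXn2r// nnegrE// (le_trans x0)// ltW.
have Fle (x y : R) : 0 <= x -> x <= y -> F x <= F y.
  by move=> x0; rewrite le_eqVlt => /predU1P[->//|] /(Fhomo _ _ x0)/ltW.
have mG : measurable_fun (`]0, +oo[%classic : set R) G.
  by apply: open_continuous_measurable_fun => // x; rewrite inE/=; exact: cG.
have key k : (\int[leb]_(s in V k) (G s)%:E = \int[leb]_(t in U k) (G (t ^+ 2 / 2) * t)%:E)%E.
  rewrite (@integration_by_substitution_increasing _ F)//.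
  - by apply: eq_integral => t _ /=; rewrite F'E.
  - move=> x y; rewrite !in_itv/= => /andP[x1 _] _; apply: Fhomo.
    by rewrite (le_trans _ x1)// ltW.
  - by rewrite F'E => ? _; exact: cvg_id.
  - by rewrite F'E; apply/cvg_ex; exists k.+1%:R^-1; apply: cvg_at_right_filter; exact: cvg_id.
  - by rewrite F'E; apply/cvg_ex; exists k.+1%:R; apply: cvg_at_left_filter; exact: cvg_id.
  - split.
    + by move=> t _; exact: ex_derive.
    + by apply: cvg_at_right_filter; exact: cF.
    + by apply: cvg_at_left_filter; exact: cF.
  - apply: continuous_in_subspaceT => x; rewrite inE/= => xV; apply: cG.
    move: xV; rewrite !in_itv/= => /andP[x1 _]; rewrite andbT (lt_le_trans _ x1)//.
    by rewrite divr_gt0// exprn_gt0.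
have UV k : U k `<=` `]0, +oo[%classic.
  rewrite -bigcup_itv_inv.
  exact: (@bigcup_sup _ _ k setT (fun k => `[k.+1%:R^-1, k.+1%:R]%classic : set R)).
have VV k : V k `<=` `]0, +oo[%classic.
  move=> x/=; rewrite /V/= !in_itv/= => /andP[x1 _]; rewrite andbT (lt_le_trans _ x1)//.
  by rewrite divr_gt0// exprn_gt0.
have Vcup : \bigcup_k V k = `]0, +oo[%classic.
  apply/seteqP; split => [x [k _] /VV//|x /= x0].
  (* On the positive reals, F is inverted by s |-> sqrt (2 s). *)
  have s0 : 0 < Num.sqrt (2 * x).
    by move: x0; rewrite in_itv/= andbT => x0; rewrite sqrtr_gt0 mulr_gt0.
  have : (\bigcup_k `[k.+1%:R^-1, k.+1%:R]%classic : set R) (Num.sqrt (2 * x)).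
    by rewrite bigcup_itv_inv/= in_itv/= s0.
  move=> [k _]; rewrite /= in_itv/= => /andP[k1 k2]; exists k => //.
  have -> : x = F (Num.sqrt (2 * x)).
    rewrite /F sqr_sqrtr; first by field.
    by move: x0; rewrite in_itv/= andbT => /ltW x0; rewrite mulr_ge0.
  by rewrite /V/= in_itv/= !Fle// ltW.
have inv_le (k l : nat) : (k <= l)%N -> l.+1%:R^-1 <= k.+1%:R^-1 :> R.
  by move=> kl; rewrite lef_pV2 ?posrE// ler_nat.
have ndU : nondecreasing_seq U.
  move=> k l kl; apply/subsetPset => x; rewrite /U/= !in_itv/= => /andP[x1 x2].
  by rewrite (le_trans (inv_le _ _ kl) x1)/= (le_trans x2)// ler_nat.
have ndV : nondecreasing_seq V.
  move=> k l kl; apply/subsetPset => x; rewrite /V/= !in_itv/= => /andP[x1 x2].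
  apply/andP; split; first by rewrite (le_trans _ x1)// Fle// ?inv_le// ltW.
  by rewrite (le_trans x2)// Fle// ler_nat.
have mGF : measurable_fun (`]0, +oo[%classic : set R) (fun t => G (t ^+ 2 / 2) * t).
  apply: open_continuous_measurable_fun => // t.
  rewrite inE/= in_itv/= andbT => t0.
  have Ft : F t \in `]0, +oo[ by rewrite in_itv/= andbT divr_gt0// exprn_gt0.
  exact: (continuousM (continuous_comp (cF t) (cG _ Ft)) (@cvg_id _ (nbhs t))).
have cU := @ge0_nondecreasing_set_cvg_integral _ (measurableTypeR R) R U
  (fun t => (G (t ^+ 2 / 2) * t)%:E) leb ndU.
have cV := @ge0_nondecreasing_set_cvg_integral _ (measurableTypeR R) R V
  (fun t => (G t)%:E) leb ndV.
rewrite -bigcup_itv_inv -[RHS](cvg_lim _ (cU _ _ _))//; last 3 first.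
- by move=> k; exact: measurable_itv.
- by move=> k; apply/measurable_EFinP; exact: measurable_funS mGF.
- move=> k x /UV/=; rewrite in_itv/= andbT lee_fin => x0.
  by rewrite mulr_ge0 ?(ltW x0)// G0// divr_gt0// exprn_gt0.
rewrite bigcup_itv_inv -Vcup -[LHS](cvg_lim _ (cV _ _ _))//; last 3 first.
- by move=> k; exact: measurable_itv.
- by move=> k; apply/measurable_EFinP; exact: measurable_funS mG.
- by move=> k x /VV/=; rewrite in_itv/= andbT lee_fin => x0; rewrite G0.
by congr (limn _); apply/funext => k; exact: key.
Qed.
End half_line.

Section gaussian_moments.
Context {R : realType}.
Local Notation leb := (@lebesgue_measure R).

Implicit Types a t : R.

Definition gauss_weight (a t : R) : R := expR (- (t ^+ 2 / 2)) * `|t| `^ a.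

Lemma gauss_weight_ge0 a t : 0 <= gauss_weight a t.
Proof. by rewrite mulr_ge0 ?expR_ge0 ?powR_ge0. Qed.

Lemma measurable_gauss_weight a : measurable_fun setT (gauss_weight a).
Proof.
apply: measurable_funM.
  apply: measurableT_comp => //; apply: measurableT_comp => //.
  by apply: measurable_funM => //; exact: measurable_funX.
by apply: (measurableT_comp (measurable_powR a)); exact: normr_measurable.
Qed.

Lemma gauss_weight_even a t : gauss_weight a (- t) = gauss_weight a t.
Proof. by rewrite /gauss_weight sqrrN normrN. Qed.

Lemma ge0_even_integral (f : R -> R) : measurable_fun setT f ->
  (forall t, 0 <= f t) -> (forall t, f (- t) = f t) ->
  (\int[leb]_t (f t)%:E = 2%:E * \int[leb]_(t in `]0%R, +oo[) (f t)%:E)%E.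
Proof.
move=> mf f0 fN.
have mposc : measurable (`[0, +oo[%classic : set R) by exact: measurable_itv.
rewrite (@integral_itv_obnd_cbnd R 0 +oo%O (EFin \o f)); last first.
  by apply/measurable_EFinP; exact: measurable_funTS.
rewrite -(setUv (`[0, +oo[%classic : set R)) ge0_integral_setU//=; last 4 first.
- exact: measurableC.
- by rewrite setUv; exact/measurable_EFinP.
- by move=> t _; rewrite lee_fin.
- exact/disj_setPCl.
rewrite mule_natl mule2n; congr (_ + _)%E.
rewrite setCitvr integral_itv_bndo_bndc; last first.
  by apply/measurable_EFinP; exact: measurable_funTS.
rewrite (@ge0_integration_by_substitution0 R (EFin \o f)); last 2 first.
- exact/measurable_EFinP.
- by move=> t; rewrite lee_fin.
by apply: eq_integral => t _ /=; rewrite fN.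
Qed.

(** From ln t <= t - 1 and (a + 1 - t)^2 >= 0. *)
Lemma gauss_weight_le_expR a t : 0 <= a -> 0 < t ->
  gauss_weight a t <= expR ((a + 1) ^+ 2 / 2) * expR (- t).
Proof.
move=> a0 t0; rewrite /gauss_weight gtr0_norm//.
have -> : t `^ a = expR (a * ln t) by rewrite /powR gt_eqF.
rewrite -!expRD ler_expR.
have : ln t <= t - 1.
  by have := le_ln1Dx (_ : -1 < t - 1); rewrite subrKC; apply; lra.
move=> /(ler_wpM2l a0).
have := sqr_ge0 (a + 1 - t); rewrite !expr2. nra.
Qed.

Lemma integral_gauss_weight_lty a : 0 <= a ->
  (\int[leb]_(t in `]0%R, +oo[) (gauss_weight a t)%:E < +oo)%E.
Proof.
move=> a0; set K := expR ((a + 1) ^+ 2 / 2).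
have K0 : 0 <= K by exact: expR_ge0.
apply: (@le_lt_trans _ _ (K%:E * \int[leb]_(t in `]0%R, +oo[) (exponential_pdf 1 t)%:E)%E).
  rewrite -ge0_integralZl//; last 2 first.
  - apply/measurable_EFinP; apply: measurable_funTS; exact: measurable_exponential_pdf.
  - by move=> t _; rewrite lee_fin exponential_pdf_ge0.
  apply: ge0_le_integral => //.
  - by move=> t _; rewrite lee_fin gauss_weight_ge0.
  - apply/measurable_EFinP; apply: measurable_funTS; exact: measurable_gauss_weight.
  - apply/measurable_EFinP; apply: measurable_funTS; apply: measurable_funM => //.
    exact: measurable_exponential_pdf.
  - move=> t /=; rewrite in_itv/= andbT -EFinM lee_fin => t0.
    by rewrite exponential_pdfE ?(ltW t0)// mul1r mulN1r; exact: gauss_weight_le_expR.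
rewrite lte_mul_pinfty//.
apply: (@le_lt_trans _ _ (\int[leb]_t (exponential_pdf 1 t)%:E)%E).
  apply: ge0_subset_integral => //.
  - by apply/measurable_EFinP; exact: measurable_exponential_pdf.
  - by move=> t _; rewrite lee_fin exponential_pdf_ge0.
by rewrite integral_exponential_pdf// ltry.
Qed.

Lemma integral_gauss_weight_gt0 a : 0 <= a ->
  (0 < \int[leb]_(t in `]0%R, +oo[) (gauss_weight a t)%:E)%E.
Proof.
move=> a0.
apply: (@lt_le_trans _ _ (\int[leb]_(t in `[1%R, 2%R]) (expR (- 2))%:E)%E).
  rewrite integral_cst//= lebesgue_measure_itv/= lte_fin ltr1n -EFinD -EFinM lte_fin.
  by apply: mulr_gt0; [exact: expR_gt0|rewrite subr_gt0 ltr1n].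
apply: (@le_trans _ _ (\int[leb]_(t in `[1%R, 2%R]) (gauss_weight a t)%:E)%E).
  apply: ge0_le_integral => //.
  - apply/measurable_EFinP; apply: measurable_funTS; exact: measurable_gauss_weight.
  - move=> t /=; rewrite in_itv/= lee_fin => /andP[t1 t2].
    rewrite /gauss_weight -[leLHS]mulr1; apply: ler_pM => //.
    + by rewrite ler_expR; nra.
    + rewrite ger0_norm ?(le_trans _ t1)//.
      have : 1 `^ a <= t `^ a by rewrite ge0_ler_powR// nnegrE// (le_trans _ t1).
      by rewrite powR1.
apply: ge0_subset_integral => //.
- apply/measurable_EFinP; apply: measurable_funTS; exact: measurable_gauss_weight.
- by move=> t _; rewrite lee_fin gauss_weight_ge0.
- by move=> t /=; rewrite !in_itv/= andbT => /andP[t1 _]; rewrite (lt_le_trans _ t1).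
Qed.

(** The substitution s = t^2 / 2 in the integral defining the Gamma function. *)
Lemma integral_gauss_weight_half a : 0 <= a ->
  (\int[leb]_(t in `]0%R, +oo[) (gauss_weight a t)%:E =
   (2 `^ ((a - 1) / 2) * Gamma_fun ((a + 1) / 2))%:E)%E.
Proof.
move=> a0; pose b := (a + 1) / 2.
have := integral_gauss_weight_lty _ a0; have := integral_gauss_weight_gt0 _ a0.
set J := (\int[leb]_(t in _) _)%E => J0 Jfin.
have Jr : J = (fine J)%:E by rewrite fineK// ge0_fin_numE// ltW.
suff GJ : Gamma_fun b = 2 `^ ((1 - a) / 2) * fine J.
  rewrite -/b GJ mulrA -powRD; last by rewrite pnatr_eq0 implybT.
  by rewrite (_ : _ + _ = 0) ?powRr0 ?mul1r//; field.
rewrite /Gamma_fun /Rintegral.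
rewrite (@ge0_integral_half_sqr R (fun s => s `^ (b - 1) * expR (- s))); last 2 first.
- by move=> s _; rewrite mulr_ge0 ?powR_ge0 ?expR_ge0.
- move=> s; rewrite in_itv/= andbT => s0.
  apply: differentiable_continuous; apply/derivable1_diffP.
  apply: derivableM; last exact: ex_derive.
  by apply: derivable_powR; rewrite in_itv/= s0.
transitivity (fine ((2 `^ ((1 - a) / 2))%:E * J)%E); last by rewrite Jr.
congr fine; rewrite -ge0_integralZl//; last 2 first.
- apply/measurable_EFinP; apply: measurable_funTS; exact: measurable_gauss_weight.
- by move=> t _; rewrite lee_fin gauss_weight_ge0.
apply: eq_integral => t; rewrite inE/= in_itv/= andbT => t0.
rewrite -EFinM; congr EFin; rewrite /gauss_weight gtr0_norm//.
have -> : (t ^+ 2 / 2) `^ (b - 1) = 2 `^ ((1 - a) / 2) * t `^ (a - 1).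
  have -> : (1 - a) / 2 = -1 * (b - 1) by rewrite /b; field.
  have -> : a - 1 = 2%:R * (b - 1) by rewrite /b; field.
  rewrite !powRrM powR_mulrn ?(ltW t0)// powR_inv1//.
  by rewrite mulrC powRM ?invr_ge0 ?exprn_ge0// ltW.
have -> : t `^ a = t `^ (a - 1) * t.
  rewrite -[X in _ * X]powRr1 ?(ltW t0)// -powRD ?subrK//.
  by rewrite (gt_eqF t0) implybT.
ring.
Qed.

Lemma Gamma_fun_half_gt0 a : 0 <= a -> 0 < Gamma_fun ((a + 1) / 2) :> R.
Proof.
move=> a0; have := integral_gauss_weight_gt0 _ a0.
by rewrite integral_gauss_weight_half// lte_fin pmulr_rgt0// powR_gt0.
Qed.

End gaussian_moments.

(** * The monomial weight and its Gaussian integrals *)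

Section monomial_weights.
Context {R : realType} {n : nat} (A : 'rV[R]_n).
Local Notation mu := (lebesgue_rV R n).
Implicit Types x : 'rV[R]_n.

Lemma mono_ge0 x : 0 <= mono x A.
Proof. by apply: prodr_ge0 => i _; exact: powR_ge0. Qed.

Lemma measurable_mono : measurable_fun setT (fun x => mono x A).
Proof.
apply: measurable_prod => i _; apply: (measurableT_comp (measurable_powR _)).
apply: (measurableT_comp (f := fun t : R => `|t|)); first exact: normr_measurable.
exact: measurable_rV_coord.
Qed.

Lemma homogeneous_mono : homogeneous_weight (\sum_i A 0 i) (fun x => mono x A).
Proof.
split; [exact: measurable_mono|exact: mono_ge0|] => t x.
rewrite mulr_sumr expR_sum -big_split/=; apply: eq_bigr => i _.
by rewrite mxE normrM powRM// (gtr0_norm (expR_gt0 t)) expRM.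
Qed.

Definition posorthant_weight x : R := mono x A * \1_(posorthant A) x.

Lemma measurable_posorthant : measurable (posorthant A).
Proof.
rewrite (_ : posorthant A = \bigcap_(i in [set: 'I_n])
   (if 0 < A 0 i then rV_coord i @^-1` `]0, +oo[%classic else setT)).
  apply: fin_bigcap_measurable => // i _; case: ifP => // _.
  by rewrite -[X in measurable X]setTI; exact: measurable_rV_coord.
apply/seteqP; split => [x xP i _|x xP i Ai].
  by case: ifPn => // Ai; rewrite /= in_itv/= andbT; exact: xP.
by have := xP i I; rewrite Ai /= in_itv/= andbT.
Qed.

Lemma homogeneous_posorthant_weight :
  homogeneous_weight (\sum_i A 0 i) posorthant_weight.
Proof.
have [mm m0 mh] := homogeneous_mono.
split => [|x|t x].
- by apply: measurable_funM => //; exact: measurable_indic measurable_posorthant.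
- by rewrite mulr_ge0.
- rewrite /posorthant_weight mh -mulrA; congr (_ * (_ * _)).
  rewrite !indicE; congr ((nat_of_bool _)%:R); apply/idP/idP; rewrite !inE => xP i Ai.
    by have := xP i Ai; rewrite mxE pmulr_rgt0// expR_gt0.
  by rewrite mxE pmulr_rgt0 ?expR_gt0//; exact: xP.
Qed.

(** Moving the domain into the density makes the weight homogeneous on the
    whole space, since the domain is a cone. *)
Lemma integral_posorthant (F : 'rV[R]_n -> R) :
  (\int[mu]_(x in posorthant A) (F x * mono x A)%:E = wint posorthant_weight F)%E.
Proof.
rewrite integral_mkcond; apply: eq_integral => x _.
rewrite patchE /posorthant_weight indicE; case: ifPn => _; first by rewrite mulr1.
by rewrite !mulr0.
Qed.

Lemma gauss_prodE x : expR (- (sqnorm x / 2)) * mono x A =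
  \prod_i gauss_weight (A 0 i) (x 0 i).
Proof.
rewrite /sqnorm mulr_suml -sumrN expR_sum -big_split/=.
by apply: eq_bigr.
Qed.

(** The factor of the indicator of the cone that belongs to one coordinate. *)
Definition halfline_if (b : bool) (t : R) : R := if b then (0 < t)%R%:R else 1.

Lemma posorthant_prodE x : \1_(posorthant A) x = \prod_i halfline_if (0 < A 0 i) (x 0 i).
Proof.
rewrite indicE; have [xP|xP] := boolP (x \in posorthant A).
  rewrite big1// => i _; rewrite /halfline_if; case: ifPn => // Ai.
  by move: xP; rewrite inE => /(_ i Ai) ->.
have [i [Ai xi]] : exists i, 0 < A 0 i /\ ~~ (0 < x 0 i).
  apply: contrapT => H; move/negP: xP; apply; rewrite inE => i Ai.
  by apply/negPn/negP => xi; apply: H; exists i.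
by rewrite (bigD1 i)//= /halfline_if Ai (negbTE xi) mul0r.
Qed.

Lemma integral_gauss_half (a : R) (b : bool) : 0 <= a ->
  (\int[@lebesgue_measure R]_t (gauss_weight a t * halfline_if b t)%:E =
   ((if b then 2^-1 else 1) * (2 `^ ((a + 1) / 2) * Gamma_fun ((a + 1) / 2)))%:E)%E.
Proof.
move=> a0.
have E2 : 2 `^ ((a + 1) / 2) = 2 * 2 `^ ((a - 1) / 2) :> R.
  rewrite (_ : (a + 1) / 2 = 1 + (a - 1) / 2); last by field.
  by rewrite powRD ?pnatr_eq0 ?implybT// powRr1.
case: b; rewrite /halfline_if.
  rewrite E2 !mulrA mulVf ?mul1r ?pnatr_eq0// -integral_gauss_weight_half//.
  rewrite [RHS]integral_mkcond; apply: eq_integral => t _.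
  rewrite patchE mem_setE in_itv/= andbT.
  by case: ifPn => _; rewrite ?mulr1 ?mulr0.
under eq_integral do rewrite mulr1.
rewrite ge0_even_integral; last 3 first.
- exact: measurable_gauss_weight.
- exact: gauss_weight_ge0.
- exact: gauss_weight_even.
by rewrite integral_gauss_weight_half// -EFinM mul1r E2 mulrA.
Qed.

Lemma measurable_half_of b : measurable_fun setT (halfline_if b).
Proof.
rewrite /halfline_if; case: b => //.
rewrite (_ : (fun _ => _) = \1_(`]0, +oo[%classic : set R)).
  exact: measurable_indic.
apply/funext => t; rewrite indicE; congr ((nat_of_bool _)%:R).
by rewrite mem_setE in_itv/= andbT.
Qed.

Lemma half_of_ge0 b t : 0 <= halfline_if b t.
Proof. by rewrite /halfline_if; case: ifP. Qed.

Hypothesis hA : forall i, 0 <= A 0 i.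

(** Each coordinate contributes 2^((A_i + 1) / 2) Gamma((A_i + 1) / 2), halved
    when A_i > 0; the exponents add up to D / 2. *)
Lemma gauss_posorthant :
  wint posorthant_weight (fun x => expR (- (sqnorm x / 2))) =
  (2 `^ (homdim A / 2) * (2 ^- #|[pred i | 0 < A 0 i]| *
     \prod_i Gamma_fun ((A 0 i + 1) / 2)))%:E.
Proof.
rewrite /wint.
(* Both the Gaussian density and the indicator of the cone are products of
   functions of one coordinate. *)
transitivity (\int[mu]_x (\prod_i (gauss_weight (A 0%R i) (x 0%R i) *
    halfline_if (0 < A 0 i) (x 0%R i))%R)%:E)%E.
  apply: eq_integral => x _; congr EFin.
  by rewrite big_split/= -gauss_prodE -posorthant_prodE mulrA.
rewrite (@ge0_integral_prod_rV R n (fun i t => gauss_weight (A 0 i) t *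
    halfline_if (0 < A 0 i) t)); last 2 first.
- move=> i; apply: measurable_funM; last exact: measurable_half_of.
  exact: measurable_gauss_weight.
- by move=> i t; rewrite mulr_ge0 ?gauss_weight_ge0 ?half_of_ge0.
rewrite (eq_bigr _ (fun i _ => integral_gauss_half _ _ (hA i))) prodEFin; congr EFin.
rewrite big_split/= big_split/= [in RHS]mulrCA; congr (_ * (_ * _)).
  by rewrite -big_mkcond/= prodr_const exprVn.
transitivity (expR (\sum_i ((A 0 i + 1) / 2) * ln 2) : R).
  by rewrite expR_sum; apply: eq_bigr => i _; rewrite /powR pnatr_eq0.
rewrite -mulr_suml -mulr_suml big_split/= sumr_const card_ord.
by rewrite /powR pnatr_eq0/= /homdim addrC.
Qed.

Lemma gauss_mono_lty :
  (wint (fun x => mono x A) (fun x => expR (- (sqnorm x / 2))) < +oo)%E.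
Proof.
rewrite /wint.
under eq_integral do rewrite gauss_prodE.
rewrite (@ge0_integral_prod_rV R n (fun i => gauss_weight (A 0 i))); last 2 first.
- by move=> i; exact: measurable_gauss_weight.
- by move=> i t; exact: gauss_weight_ge0.
have E i : (\int[@lebesgue_measure R]_t (gauss_weight (A 0%R i) t)%:E)%E =
   (1 * (2 `^ ((A 0 i + 1) / 2) * Gamma_fun ((A 0 i + 1) / 2)))%:E.
  rewrite -(integral_gauss_half _ false)//.
  by apply: eq_integral => t _; rewrite /halfline_if mulr1.
by under eq_bigr do rewrite E; rewrite prodEFin ltry.
Qed.

End monomial_weights.

(** * Radial functions *)

Section radial.
Context {R : realType} {n : nat}.
Implicit Types (x v : 'rV[R]_n).
Variables (H dH : R -> R).
Hypothesis dHE : forall u : R, is_derive u (1 : R) H (dH u).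
Hypothesis cdH : continuous dH.

Definition radial x : R := H (sqnorm x).

Lemma differentiable_sqnorm x : differentiable (@sqnorm R n) x.
Proof.
rewrite (_ : @sqnorm R n = \sum_(i < n) (fun x : 'rV[R]_n => x 0 i ^+ 2)).
  apply: differentiable_sum => i.
  have dx := @differentiable_coord R 1 n x 0 i.
  exact: (differentiableM dx dx).
by apply/funext => y; rewrite fct_sumE.
Qed.

Lemma differentiable_radial x : differentiable radial x.
Proof.
apply: (@differentiable_comp _ _ _ _ (@sqnorm R n) H).
  exact: differentiable_sqnorm.
by apply/derivable1_diffP; have [] := dHE (sqnorm x).
Qed.

Lemma sqnorm_line x v (h : R) :
  sqnorm (h *: v + x) = h ^+ 2 * sqnorm v + h * (2 * dotr v x) + sqnorm x.
Proof.
rewrite /sqnorm /dotr !mulr_sumr -!big_split/=; apply: eq_bigr => i _.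
by rewrite !mxE; ring.
Qed.

(** Along the line h |-> h v + x, |.|^2 is a quadratic polynomial in h, so the
    one-variable chain rule suffices. *)
Lemma derive_radial x v : 'D_v radial x = dH (sqnorm x) * (2 * dotr v x).
Proof.
pose p (h : R) : R := h ^+ 2 * sqnorm v + h * (2 * dotr v x) + sqnorm x.
have p0 : p 0 = sqnorm x by rewrite /p expr0n !mul0r !add0r.
have dp : is_derive (0 : R) (1 : R) p (2 * dotr v x).
  by apply: is_derive_eq; rewrite /GRing.scale/=; ring.
have dHp : is_derive (p 0) (1 : R) H (dH (sqnorm x)) by rewrite p0; exact: dHE.
have [_ <-] := @is_derive1_comp R H p 0 _ _ dHp dp.
rewrite /derive; set g1 := fun h => h^-1 *: _; set g2 := fun h => h^-1 *: _.
suff -> : g1 = g2 by [].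
apply/funext => h; rewrite /g1 /g2 /=.
by rewrite /radial sqnorm_line addr0 [_%:A]mulr1 p0.
Qed.

Lemma grad_radial x : grad radial x = (2 * dH (sqnorm x)) *: x.
Proof.
apply/rowP => i; rewrite !mxE derive_radial /dotr (bigD1 i)//= big1 => [|j ji].
  by rewrite mxE !eqxx/=; ring.
by rewrite mxE (negbTE ji) andbF mul0r.
Qed.

Lemma continuous_radial : continuous radial.
Proof. by move=> x; apply: differentiable_continuous; exact: differentiable_radial. Qed.

Lemma continuous_grad_radial : continuous (grad radial).
Proof.
rewrite (_ : grad radial = fun x => (2 * dH (sqnorm x)) *: x); last first.
  by apply/funext => x; rewrite grad_radial.
move=> x; apply: (@continuousZ _ _ _ (fun x => 2 * dH (sqnorm x)) id); last exact: cvg_id.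
exact: (continuousM (@cst_continuous _ _ (2 : R) x)
  (continuous_comp (continuous_sqnorm x) (cdH (sqnorm x)))).
Qed.

Lemma C1c_radial (r : R) : (forall u, r < u -> H u = 0) -> C1c radial.
Proof.
move=> Hr; split; [exact: differentiable_radial|exact: continuous_grad_radial|].
have cl : closure [set x | radial x != 0] `<=` [set x | sqnorm x <= r].
  have clq : closed [set x : 'rV[R]_n | sqnorm x <= r].
    rewrite (_ : mkset _ = ~` (@sqnorm R n @^-1` [set u | r < u])).
      apply: open_closedC.
      by move/continuousP : (@continuous_sqnorm R n); apply; exact: open_gt.
    by apply/seteqP; split => x /=; rewrite leNgt => /negP.
  rewrite [X in _ `<=` X]((closure_id _).1 clq); apply: closureS => x /= Hx.
  by rewrite leNgt; apply: contra Hx => /Hr; rewrite /radial => ->.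
apply: bounded_closed_compact; last exact: closed_closure.
exists (1 + r); split; first exact: num_real.
move=> M rM x /cl /= xr; rewrite [leLHS]/Num.norm/= mx_normrE.
have q0 := sqnorm_ge0 x.
apply: bigmax_le => [|[i j] _]; first by move: rM xr q0; lra.
rewrite /= ord1 (le_trans _ (ltW rM))//.
have : x 0 j ^+ 2 <= sqnorm x.
  by rewrite /sqnorm (bigD1 j)//= lerDl sumr_ge0// => k _; exact: sqr_ge0.
rewrite -real_normK ?num_real//; have := normr_ge0 (x 0 j).
by set t := `|_|; nra.
Qed.

End radial.

Section quadratic_derivative.
Context {R : realType}.

(** Used for the square of the positive part, which is not twice differentiable
    at 0 and hence not a composite of smooth functions. *)
Lemma is_derive_of_quadratic_error (F : R -> R) (y d : R) :
  (forall h, `|F (h + y) - F y - h * d| <= h ^+ 2) -> is_derive y (1 : R) F d.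
Proof.
move=> Fd.
(* The difference quotient is within |h| of d. *)
have Fl : (h^-1 *: ((F \o shift y) (h *: (1 : R)) - F y)) @[h --> (0 : R)^'] --> d.
  apply/cvgrPdist_le => e e0; near=> h.
  have h0 : h != 0 by near: h; exact: nbhs_dnbhs_neq.
  have he : `|h| <= e by near: h; exact: dnbhs0_le.
  rewrite /= [h%:A]mulr1 /GRing.scale/=.
  have -> : d - h^-1 * (F (h + y) - F y) = - (h^-1 * (F (h + y) - F y - h * d)).
    by field.
  rewrite normrN normrM normfV ler_pdivrMl ?normr_gt0// (le_trans (Fd h))//.
  by rewrite -(real_normK (num_real h)) expr2 ler_wpM2l.
apply: DeriveDef; first by apply/cvg_ex; exists d; exact: Fl.
exact: (cvg_lim _ Fl).
Unshelve. all: by end_near. Qed.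

Lemma is_derive_sqr_pospart (y : R) :
  is_derive y (1 : R) (fun u => (Num.max 0 u) ^+ 2) (2 * Num.max 0 y).
Proof.
apply: is_derive_of_quadratic_error => h.
rewrite ler_norml; case: (leP 0 (h + y)) => hy; case: (leP 0 y) => y0;
  apply/andP; split; nra.
Qed.

Lemma continuous_pospart : continuous (fun u : R => Num.max 0 u).
Proof.
rewrite (_ : (fun u => _) = (fun u : R => (u + `|u|) / 2)).
  move=> u.
  have c1 := continuousD (@cvg_id _ (nbhs u)) (@norm_continuous _ _ u).
  exact: (continuousM c1 (@cst_continuous _ _ (2^-1 : R) u)).
apply/funext => u; case: (leP 0 u) => u0; first by rewrite ger0_norm//; field.
by rewrite ltr0_norm// subrr mul0r.
Qed.

End quadratic_derivative.

(** * The Gaussian is a limit of compactly supported C^1 functions *)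

Section profiles.
Context {R : realType}.
Variables (k d : R).
Implicit Types u : R.

Definition gauss_profile u : R := expR (- (u / 4)) * k.
Definition gauss_profile' u : R := - (4^-1 * gauss_profile u).
(** The Gaussian, as a function of u = |x|^2, times (1 - d u)_+^2. The square
    makes it of class C^1 at u = 1 / d. *)
Definition cut_profile u : R := gauss_profile u * Num.max 0 (1 - d * u) ^+ 2.
Definition cut_profile' u : R :=
  gauss_profile' u * Num.max 0 (1 - d * u) ^+ 2 -
  2 * d * gauss_profile u * Num.max 0 (1 - d * u).

Lemma is_derive_gauss_profile u : is_derive u (1 : R) gauss_profile (gauss_profile' u).
Proof.
rewrite /gauss_profile' /gauss_profile; apply: is_derive_eq.
by rewrite /GRing.scale/=; field.
Qed.

Lemma is_derive_cut_profile u : is_derive u (1 : R) cut_profile (cut_profile' u).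
Proof.
have dg := is_derive_gauss_profile u.
have dl : is_derive u (1 : R) (fun s : R => 1 - d * s) (- d).
  by apply: is_derive_eq; rewrite /GRing.scale/=; ring.
have dp := is_derive_sqr_pospart (1 - d * u).
have dm := @is_derive1_comp R (fun s => Num.max 0 s ^+ 2) (fun s => 1 - d * s) u _ _ dp dl.
have := @is_deriveM _ _ _ _ _ _ _ _ dg dm.
move=> dgm; apply: (@is_derive_eq _ _ _ _ _ _ _ _ dgm).
by rewrite /cut_profile' /GRing.scale/=; ring.
Qed.

Lemma continuous_gauss_profile : continuous gauss_profile.
Proof.
move=> u; apply: differentiable_continuous; apply/derivable1_diffP.
by have [] := is_derive_gauss_profile u.
Qed.

Lemma continuous_gauss_profile' : continuous gauss_profile'.
Proof.
move=> u; have c1 := continuousM (@cst_continuous _ _ (4^-1 : R) u) (continuous_gauss_profile u).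
exact: (continuousN c1).
Qed.

Lemma continuous_cut_profile' : continuous cut_profile'.
Proof.
have cm : continuous (fun u : R => Num.max 0 (1 - d * u)).
  move=> u.
  have c1 := continuousM (@cst_continuous _ _ (d : R) u) (@cvg_id _ (nbhs u)).
  have c2 := continuousB (@cst_continuous _ _ (1 : R) u) c1.
  exact: (continuous_comp c2 (continuous_pospart (1 - d * u))).
move=> u.
have c1 := continuousM (cm u) (cm u).
have c2 := continuousM (continuous_gauss_profile' u) c1.
have c3 := continuousM (@cst_continuous _ _ (2 * d : R) u) (continuous_gauss_profile u).
exact: (continuousB c2 (continuousM c3 (cm u))).
Qed.

Lemma cut_profile_eq0 u : 0 < d -> d^-1 < u -> cut_profile u = 0.
Proof.
move=> d0 du; rewrite /cut_profile; case: leP; rewrite ?expr0n ?mulr0// => h.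
by move: du; rewrite -(ltr_pM2l d0) divff ?gt_eqF//; lra.
Qed.

(** The cube of 1 + y <= e^y at y = u / 12. *)
Lemma cubic_le_expR u : 0 <= u -> (u + 12) ^+ 3 <= 12 ^+ 3 * expR (u / 4).
Proof.
move=> u0.
have -> : u / 4 = 3%:R * (u / 12) by field.
rewrite expRM_natl -exprMn lerXn2r ?nnegrE ?mulr_ge0 ?addr_ge0 ?expR_ge0//.
have : 1 + u / 12 <= expR (u / 12) by exact: expR_ge1Dx.
by lra.
Qed.

(** With m the positive part of 1 - d u, one has 1 - m^2 <= 2 d u and m <= 1, so
    the left-hand side is at most d^2 g^2 times a cubic polynomial in u, which
    half of the exponential in g^2 absorbs. *)
Lemma cut_profile_error u : 0 < d -> 0 <= u ->
  (gauss_profile u - cut_profile u) ^+ 2 +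
  4 * u * (gauss_profile' u - cut_profile' u) ^+ 2 <=
  d ^+ 2 * k ^+ 2 * 12 ^+ 3 * expR (- (u / 4)).
Proof.
move=> d0 u0; rewrite /cut_profile /cut_profile' /gauss_profile'.
set m := Num.max 0 _; set g := gauss_profile u.
have m0 : 0 <= m by rewrite /m le_max lexx.
have m1 : m <= 1 by rewrite /m ge_max ler01/= gerBl mulr_ge0// ltW.
have md : 1 - d * u <= m by rewrite /m le_max lexx orbT.
have s0 : 0 <= 1 - m ^+ 2 by nra.
have s1 : 1 - m ^+ 2 <= 2 * (d * u) by nra.
have du0 : 0 <= d * u by rewrite mulr_ge0// ltW.
have -> : (g - g * m ^+ 2) ^+ 2 + 4 * u *
    (- (4^-1 * g) - (- (4^-1 * g) * m ^+ 2 - 2 * d * g * m)) ^+ 2 =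
    g ^+ 2 * ((1 - m ^+ 2) ^+ 2 + 4 * u * (2 * d * m - 4^-1 * (1 - m ^+ 2)) ^+ 2).
  by field.
have h1 : (1 - m ^+ 2) ^+ 2 <= (2 * (d * u)) ^+ 2 by rewrite lerXn2r// nnegrE// mulr_ge0.
have h2 : (2 * d * m - 4^-1 * (1 - m ^+ 2)) ^+ 2 <= (d * (u / 2 + 2)) ^+ 2.
  rewrite -real_normK ?num_real// lerXn2r ?nnegrE ?mulr_ge0 ?addr_ge0 ?(ltW d0) ?divr_ge0//.
  rewrite ler_norml; apply/andP; split; first by nra.
  have : d * m <= d by rewrite ler_piMr// ltW.
  by nra.
have h3 : (1 - m ^+ 2) ^+ 2 + 4 * u * (2 * d * m - 4^-1 * (1 - m ^+ 2)) ^+ 2 <=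
    d ^+ 2 * (u + 12) ^+ 3.
  apply: (@le_trans _ _ ((2 * (d * u)) ^+ 2 + 4 * u * (d * (u / 2 + 2)) ^+ 2)).
    by rewrite lerD// ler_wpM2l// mulr_ge0.
  rewrite -subr_ge0 [leRHS](_ : _ = d ^+ 2 * (24 * u ^+ 2 + 416 * u + 12 ^+ 3)).
    by rewrite mulr_ge0 ?sqr_ge0// !addr_ge0// ?mulr_ge0// ?sqr_ge0.
  by field.
have gE : g ^+ 2 = k ^+ 2 * (expR (- (u / 4)) * expR (- (u / 4))).
  by rewrite /g /gauss_profile; ring.
have ee : expR (u / 4) * expR (- (u / 4)) = 1 by rewrite -expRD subrr expR0.
apply: (@le_trans _ _ (g ^+ 2 * (d ^+ 2 * (12 ^+ 3 * expR (u / 4))))).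
  rewrite ler_wpM2l ?sqr_ge0// (le_trans h3)// ler_wpM2l ?sqr_ge0//.
  exact: cubic_le_expR.
rewrite gE.
rewrite [leLHS](_ : _ = d ^+ 2 * k ^+ 2 * 12 ^+ 3 * expR (- (u / 4)) *
   (expR (u / 4) * expR (- (u / 4)))); last by ring.
by rewrite ee mulr1.
Qed.

End profiles.

Lemma poweR_half_lt (R : realType) (X : \bar R) (e : R) : (0 <= X)%E -> 0 < e ->
  (X `^ 2^-1 < e%:E)%E = (X < (e ^+ 2)%:E)%E.
Proof.
case: X => [r| |]// r0 e0; last by rewrite poweRyr ?invr_eq0 ?pnatr_eq0.
rewrite poweR_EFin !lte_fin powR12_sqrt//.
by rewrite -{1}(ger0_norm (ltW e0)) -sqrtr_sqr ltr_sqrt// exprn_gt0.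
Qed.

Section H10_gauss.
Context {R : realType} {n : nat} (A : 'rV[R]_n) (k : R).
Hypothesis hA : forall i, 0 <= A 0 i.
Local Notation mu := (lebesgue_rV R n).
Local Notation f := (@radial R n (gauss_profile k)).

(** A dilation by 2^(-1/2) turns e^(-|x|^2/2) into e^(-|x|^2/4). *)
Lemma gauss_quarter_mono_lty :
  (wint (fun x => mono x A) (fun x => expR (- (sqnorm x / 4))) < +oo)%E.
Proof.
pose t := - (ln 2 / 2) : R.
have t2 : expR t ^+ 2 = 2^-1.
  by rewrite -expRM_natl (_ : 2%:R * t = - ln 2) ?expRN ?lnK ?posrE// /t; field.
have mF : measurable_fun setT (fun x : 'rV[R]_n => expR (- (sqnorm x / 2))).
  apply: measurableT_comp => //; apply: measurableT_comp => //.
  apply: measurable_funM => //.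
  exact: continuous_measurable_rV _ continuous_sqnorm.
have := ge0_integral_weight_dilation _ _ (homogeneous_mono A) t _ mF (fun x => expR_ge0 _).
have -> : (\int[mu]_x (expR (- (sqnorm (expR t *: x) / 2)) * mono x A)%:E)%E =
  wint (fun x => mono x A) (fun x => expR (- (sqnorm x / 4))).
  apply: eq_integral => x _; congr (expR (- _) * _)%:E.
  by rewrite sqnormZ t2; field.
move=> ->; rewrite lte_mul_pinfty ?lee_fin ?expR_ge0//.
exact: gauss_mono_lty.
Qed.

Lemma H10_gauss : H10 A f (grad f).
Proof.
have df := @is_derive_gauss_profile R k.
have cf := continuous_radial _ _ df (n := n).
have cgf := continuous_grad_radial _ _ df (@continuous_gauss_profile' R k) (n := n).
split; [exact: continuous_measurable_rV|exact: continuous_measurable_rV_rV|].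
move=> e e0.
have := gauss_quarter_mono_lty.
have : (0 <= wint (fun x => mono x A) (fun x => expR (- (sqnorm x / 4))))%E.
  by apply: wint_ge0 => x; [exact: mono_ge0|exact: expR_ge0].
case KE : (wint _ _) => [K| |]//; rewrite lee_fin => K0 _.
pose C := k ^+ 2 * 12 ^+ 3 * K.
have C0 : 0 <= C by apply: mulr_ge0 => //; apply: mulr_ge0 => //; exact: sqr_ge0.
(* With this d the squared distance is at most e^2 C / (1 + C)^2 < e^2. *)
pose d := e / (1 + C).
have C1 : 0 < 1 + C by rewrite ltr_wpDr.
have d0 : 0 < d by rewrite divr_gt0.
have dphi := @is_derive_cut_profile R k d.
exists (radial (cut_profile k d)).
  apply: (@C1c_radial _ _ _ (cut_profile' k d) dphi _ d^-1).
    exact: continuous_cut_profile'.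
  by move=> u; exact: cut_profile_eq0.
rewrite /H1norm.
have mexp : measurable_fun setT (fun x : 'rV[R]_n => expR (- (sqnorm x / 4))).
  apply: measurableT_comp => //; apply: measurableT_comp => //.
  apply: measurable_funM => //.
  exact: continuous_measurable_rV _ continuous_sqnorm.
have mm := measurable_mono A.
have le1 : (\int[mu]_x ((`|(f \- radial (cut_profile k d)) x| ^+ 2 +
   enorm ((grad f \- grad (radial (cut_profile k d))) x) ^+ 2) * mono x A)%:E <=
   (d ^+ 2 * C)%:E)%E.
  rewrite (_ : d ^+ 2 * C = d ^+ 2 * k ^+ 2 * 12 ^+ 3 * K); last by rewrite /C; ring.
  pose X (x : 'rV[R]_n) := (gauss_profile k (sqnorm x) - cut_profile k d (sqnorm x)) ^+ 2 +
    4 * sqnorm x * (gauss_profile' k (sqnorm x) - cut_profile' k d (sqnorm x)) ^+ 2.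
  have XE x : `|(f \- radial (cut_profile k d)) x| ^+ 2 +
      enorm ((grad f \- grad (radial (cut_profile k d))) x) ^+ 2 = X x.
    rewrite real_normK ?num_real// sqr_enorm /=.
    rewrite (grad_radial _ _ df) (grad_radial _ _ dphi) -scalerBl sqnormZ.
    by rewrite /radial /X; ring.
  have X0 x : 0 <= X x.
    by rewrite /X addr_ge0 ?sqr_ge0// mulr_ge0 ?sqr_ge0// mulr_ge0 ?sqnorm_ge0.
  have mX : measurable_fun setT X.
    have ms : measurable_fun setT (@sqnorm R n).
      exact: continuous_measurable_rV _ continuous_sqnorm.
    have mcomp (h : R -> R) : continuous h -> measurable_fun setT (fun x => h (@sqnorm R n x)).
      by move=> /continuous_measurable_fun mh; exact: (measurableT_comp mh ms).
    apply: measurable_funD.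
      apply: measurable_funX; apply: measurable_funB; apply: mcomp.
        exact: continuous_gauss_profile.
      move=> u; apply: differentiable_continuous; apply/derivable1_diffP.
      by have [] := dphi u.
    apply: measurable_funM; first exact: measurable_funM.
    apply: measurable_funX; apply: measurable_funB; apply: mcomp.
      exact: continuous_gauss_profile'.
    exact: continuous_cut_profile'.
  rewrite (_ : (\int[mu]_x _)%E = wint (fun x => mono x A) X); last first.
    by apply: eq_integral => x _; rewrite XE.
  have k0 : 0 <= d ^+ 2 * k ^+ 2 * 12 ^+ 3.
    by apply: mulr_ge0 => //; apply: mulr_ge0; exact: sqr_ge0.
  apply: (@le_trans _ _ ((d ^+ 2 * k ^+ 2 * 12 ^+ 3)%:E *
    wint (fun x => mono x A) (fun x => expR (- (sqnorm x / 4))) + 0%:E *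
    wint (fun x => mono x A) (fun x => expR (- (sqnorm x / 4))))%E).
    apply: le_wint_linear => //; [exact: mono_ge0|].
    move=> x; rewrite mul0r addr0; apply: cut_profile_error => //.
    exact: sqnorm_ge0.
  by rewrite KE mul0e adde0 EFinM.
rewrite poweR_half_lt//; last first.
  by apply: integral_ge0 => x _; rewrite lee_fin mulr_ge0 ?mono_ge0// addr_ge0 ?sqr_ge0.
apply: (le_lt_trans le1); rewrite lte_fin.
rewrite /d expr_div_n -mulrA gtr_pMr ?exprn_gt0//.
rewrite mulrC ltr_pdivrMr ?exprn_gt0// mul1r; nra.
Qed.

End H10_gauss.

(** * The sharp inequality and its Gaussian extremal *)

Section uncertainty_H10.
Context {R : realType} {n : nat} (A : 'rV[R]_n).
Hypotheses (hn : (0 < n)%N) (hA : forall i, 0 <= A 0 i).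
Local Notation mu := (lebesgue_rV R n).
Local Notation I := (wint (posorthant_weight A)).

Lemma homdim_gt0 : 0 < homdim A.
Proof. by rewrite ltr_pwDl ?ltr0n// sumr_ge0. Qed.

Lemma posorthant_weight_ge0 x : 0 <= posorthant_weight A x.
Proof. by have [] := homogeneous_posorthant_weight A. Qed.

Lemma measurable_posorthant_weight : measurable_fun setT (posorthant_weight A).
Proof. by have [] := homogeneous_posorthant_weight A. Qed.

Lemma posorthant_weight_le_mono x : posorthant_weight A x <= mono x A.
Proof.
by rewrite /posorthant_weight ler_piMr ?mono_ge0// indicE; case: (_ \in _).
Qed.

(** The H^1 norm is taken over the whole space, where the weight dominates its
    restriction to the cone. *)
Lemma H10_h1_gap (f : 'rV[R]_n -> R) (g : 'rV[R]_n -> 'rV[R]_n) (e : R) :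
  H10 A f g -> 0 < e -> exists phi,
    [/\ forall x, differentiable phi x, continuous (grad phi) &
      (I (h1_gap f phi g) <= e%:E)%E].
Proof.
move=> [mf mg H] e0.
have se0 : 0 < Num.sqrt e by rewrite sqrtr_gt0.
have [phi [dphi cphi _]] := H _ se0.
have cp : continuous phi by move=> y; exact: differentiable_continuous.
rewrite /H1norm poweR_half_lt//; last first.
  by apply: integral_ge0 => x _; rewrite lee_fin mulr_ge0 ?mono_ge0// addr_ge0 ?sqr_ge0.
rewrite sqr_sqrtr ?(ltW e0)// => Hlt.
exists phi; split => //; apply/ltW; apply: le_lt_trans Hlt.
have mgap := measurable_h1_gap f phi g mf cp mg cphi.
have gap0 x : 0 <= h1_gap f phi g x by rewrite addr_ge0 ?sqr_ge0 ?sqnorm_ge0.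
rewrite [leRHS](_ : _ = wint (fun x => mono x A) (h1_gap f phi g)); last first.
  by apply: eq_integral => x _; rewrite real_normK ?num_real// sqr_enorm.
apply: ge0_le_integral => //.
- by move=> x _; rewrite lee_fin mulr_ge0 ?posorthant_weight_ge0.
- apply/measurable_EFinP; apply: measurable_funM => //.
  exact: measurable_posorthant_weight.
- apply/measurable_EFinP; apply: measurable_funM => //; exact: measurable_mono.
- by move=> x _; rewrite lee_fin ler_wpM2l// posorthant_weight_le_mono.
Qed.

Lemma ae_sqnorm_neq0 : {ae mu, forall x, sqnorm x != 0}.
Proof.
have mu0 : mu [set x : 'rV[R]_n | forall i, [set 0] (x 0 i)] = 0%E.
  apply: etrans (@lebesgue_rV_box R n (fun=> [set 0]) (fun=> measurable_set1 _)) _.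
  rewrite (bigD1 (Ordinal hn))//=.
  by rewrite lebesgue_measure_set1 mul0e.
exists [set x : 'rV[R]_n | forall i, [set 0] (x 0 i)]; split => //.
- rewrite (_ : mkset _ = \bigcap_(i in [set: 'I_n]) (rV_coord i @^-1` [set 0])).
    apply: fin_bigcap_measurable => // i _.
    by rewrite -[X in measurable X]setTI; apply: measurable_rV_coord.
  by apply/seteqP; split=> [x + i _|x + i]; exact.
- move=> x /= /negP/negPn; rewrite psumr_eq0; last by move=> i _; exact: sqr_ge0.
  move=> /allP h i; have := h i (mem_index_enum i).
  by rewrite /= sqrf_eq0 => /eqP.
Qed.

(** A vanishing second moment would make f^2 w vanish almost everywhere, the
    origin being a null set. *)
Lemma second_moment_neq0 (w f : 'rV[R]_n -> R) :
  measurable_fun setT w -> (forall x, 0 <= w x) -> measurable_fun setT f ->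
  wint w (fun x => f x ^+ 2) = 1%E -> wint w (fun x => sqnorm x * f x ^+ 2) != 0%E.
Proof.
move=> mw w0 mf f1; apply/negP => /eqP M0.
have mf2 : measurable_fun setT (fun x => f x ^+ 2) by exact: measurable_funX.
have ms : measurable_fun setT (@sqnorm R n).
  exact: continuous_measurable_rV _ continuous_sqnorm.
have mM : measurable_fun setT (fun x => (sqnorm x * f x ^+ 2 * w x)%:E).
  by apply/measurable_EFinP; apply: measurable_funM => //; exact: measurable_funM.
have : (\int[mu]_x `|(sqnorm x * f x ^+ 2 * w x)%:E| = 0)%E.
  rewrite -M0; apply: eq_integral => x _; rewrite gee0_abs// lee_fin.
  by rewrite mulr_ge0// mulr_ge0 ?sqnorm_ge0 ?sqr_ge0.
move/(ae_eq_integral_abs mu measurableT mM) => M0'.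
have : wint w (fun x => f x ^+ 2) = 0%E.
  rewrite -(integral0 mu setT); apply: ae_eq_integral => //.
    by apply/measurable_EFinP; exact: measurable_funM.
  move: M0' ae_sqnorm_neq0; apply: filterS2 => x /= h q0 _.
  have := h Logic.I; rewrite /cst/= => -[/eqP]; rewrite -mulrA mulf_eq0 (negbTE q0)/=.
  by move=> /eqP ->.
by rewrite f1 => -[] /eqP; rewrite oner_eq0.
Qed.

Lemma uncertainty_H10 (f : 'rV[R]_n -> R) (g : 'rV[R]_n -> 'rV[R]_n) :
  H10 A f g -> I (fun x => f x ^+ 2) = 1%E ->
  (I (fun x => sqnorm x * f x ^+ 2)%R < +oo)%E ->
  ((homdim A ^+ 2 / 4)%:E <=
    I (fun x => sqnorm x * f x ^+ 2)%R * I (fun x => sqnorm (g x)))%E.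
Proof.
move=> Hf f1 Mfin; have [mf mg _] := Hf.
have hw := homogeneous_posorthant_weight A.
have mw := measurable_posorthant_weight; have w0 := posorthant_weight_ge0.
have M0 := second_moment_neq0 _ _ mw w0 mf f1.
have Mge0 : (0 <= I (fun x => sqnorm x * f x ^+ 2)%R)%E.
  by apply: wint_ge0 => // x; rewrite mulr_ge0 ?sqnorm_ge0 ?sqr_ge0.
have Gge0 : (0 <= I (fun x => sqnorm (g x)))%E.
  by apply: wint_ge0 => // x; exact: sqnorm_ge0.
case ME : (I (fun x => sqnorm x * f x ^+ 2)%R) M0 Mge0 Mfin => [M| |]// M0 Mge0 _.
case GE : (I (fun x => sqnorm (g x))) Gge0 => [G| |]// Gge0; last first.
  by rewrite gt0_muley ?leey// lt_neqAle eq_sym M0.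
rewrite -EFinM lee_fin.
have := @weighted_uncertainty R n _ _ hw homdim_gt0 f g M G mf mg
  (fun e => H10_h1_gap f g e Hf) f1 ME GE.
by case.
Qed.

End uncertainty_H10.

Section gaussian.
Context {R : realType} {n : nat} (A : 'rV[R]_n).
Hypotheses (hn : (0 < n)%N) (hA : forall i, 0 <= A 0 i).
Local Notation I := (wint (posorthant_weight A)).
Local Notation c := ((2 * Pi_const A) `^ (homdim A / 4)).

Lemma Pi_factor_gt0 :
  0 < 2 ^- #|[pred i | 0 < A 0 i]| * \prod_i Gamma_fun ((A 0 i + 1) / 2) :> R.
Proof.
rewrite mulr_gt0 ?invr_gt0 ?exprn_gt0// prodr_gt0// => i _.
exact: Gamma_fun_half_gt0.
Qed.

Lemma gaussian_constant_gt0 : 0 < c.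
Proof. by rewrite powR_gt0// mulr_gt0// powR_gt0// Pi_factor_gt0. Qed.

Lemma gaussian_constant_sqr : c ^+ 2 = 2 `^ (homdim A / 2) *
  (2 ^- #|[pred i | 0 < A 0 i]| * \prod_i Gamma_fun ((A 0 i + 1) / 2)).
Proof.
have D0 := homdim_gt0 A hn hA; have Z0 := Pi_factor_gt0.
rewrite -powR_mulrn ?powR_ge0// -powRrM powRM ?powR_ge0// /Pi_const -powRrM.
rewrite (_ : homdim A / 4 * 2%:R = homdim A / 2); last by field.
rewrite (_ : 2 / homdim A * (homdim A / 2) = 1); last by field; rewrite gt_eqF.
by rewrite powRr1// ltW.
Qed.

Lemma gaussian_extremalE :
  gaussian_extremal A = radial (gauss_profile c^-1).
Proof.
apply/funext => x; rewrite /gaussian_extremal /radial /gauss_profile.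
by rewrite sqr_enorm mulNr.
Qed.

Local Notation f := (@radial R n (gauss_profile c^-1)).

Lemma gaussian_sqrE x : f x ^+ 2 = c ^- 2 * expR (- (sqnorm x / 2)).
Proof.
rewrite /radial /gauss_profile exprMn exprVn mulrC; congr (_ * _).
by rewrite -expRM_natl; congr expR; field.
Qed.

Let mexp : measurable_fun setT (fun x : 'rV[R]_n => expR (- (sqnorm x / 2))).
Proof.
apply: measurableT_comp => //; apply: measurableT_comp => //.
apply: measurable_funM => //; exact: continuous_measurable_rV _ continuous_sqnorm.
Qed.

Lemma gaussian_mass : I (fun x => f x ^+ 2) = 1%E.
Proof.
rewrite (_ : (fun x => _) = fun x => c ^- 2 * expR (- (sqnorm x / 2))); last first.
  by apply/funext => x; rewrite gaussian_sqrE.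
rewrite wintZ//; [|exact: measurable_posorthant_weight|exact: posorthant_weight_ge0|].
  rewrite gauss_posorthant// -gaussian_constant_sqr -EFinM mulVf//.
  by rewrite expf_neq0// gt_eqF// gaussian_constant_gt0.
by rewrite invr_ge0 sqr_ge0.
Qed.

(** The virial identity for f^2, whose derivative along t |-> e^t x is
    - |x|^2 f^2. *)
Lemma gaussian_second_moment : I (fun x => sqnorm x * f x ^+ 2) = (homdim A)%:E.
Proof.
have ms : measurable_fun setT (@sqnorm R n).
  exact: continuous_measurable_rV _ continuous_sqnorm.
have mf2 : measurable_fun setT (fun x => f x ^+ 2).
  apply: measurable_funX; apply: continuous_measurable_rV.
  exact: continuous_radial _ _ (is_derive_gauss_profile _).
transitivity ((homdim A)%:E * I (fun x => f x ^+ 2)%R)%E; last first.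
  by rewrite gaussian_mass mule1.
apply/esym; apply: (virial_eq _ _ (homogeneous_posorthant_weight A) (fun x => f x ^+ 2)).
- exact: homdim_gt0.
- exact: mf2.
- by move=> x; exact: sqr_ge0.
- exact: measurable_funM.
- by move=> x; rewrite mulr_ge0 ?sqnorm_ge0 ?sqr_ge0.
- by rewrite -[X in (X < _)%E]/(I (fun x => f x ^+ 2)) gaussian_mass ltry.
- move=> x.
  pose u (t : R) := f (expR t *: x) ^+ 2.
  have uE : u = fun t => c ^- 2 * expR (- (expR t ^+ 2 * sqnorm x / 2)).
    by apply/funext => t; rewrite /u gaussian_sqrE sqnormZ.
  have du t : is_derive t (1 : R) (fun t : R => - u t)
      (sqnorm (expR t *: x) * f (expR t *: x) ^+ 2).
    rewrite uE gaussian_sqrE sqnormZ; set K := c ^- 2; apply: is_derive_eq.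
    by rewrite /GRing.scale/=; field.
  rewrite (@integral_derive01 R (fun t => - u t)
    (fun t => sqnorm (expR t *: x) * f (expR t *: x) ^+ 2)).
  + rewrite /u expR0 scale1r -EFinB -EFinD; congr EFin; ring.
  + rewrite (_ : (fun t => _) = fun t => expR t ^+ 2 * sqnorm x *
        (c ^- 2 * expR (- (expR t ^+ 2 * sqnorm x / 2)))); last first.
      by apply/funext => t; rewrite gaussian_sqrE sqnormZ.
    move=> t; apply: differentiable_continuous; apply/derivable1_diffP.
    exact: ex_derive.
Qed.

(** grad f = - x f / 2. *)
Lemma gaussian_energy : I (fun x => sqnorm (grad f x)) = (homdim A / 4)%:E.
Proof.
have ms : measurable_fun setT (@sqnorm R n).
  exact: continuous_measurable_rV _ continuous_sqnorm.
have mf2 : measurable_fun setT (fun x => f x ^+ 2).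
  apply: measurable_funX; apply: continuous_measurable_rV.
  exact: continuous_radial _ _ (is_derive_gauss_profile _).
rewrite (_ : (fun x => _) = fun x => 4^-1 * (sqnorm x * f x ^+ 2)); last first.
  apply/funext => x; rewrite (grad_radial _ _ (is_derive_gauss_profile _)) sqnormZ.
  by rewrite /gauss_profile' /radial; field.
rewrite wintZ ?gaussian_second_moment//.
- by rewrite -EFinM mulrC.
- exact: measurable_posorthant_weight.
- exact: posorthant_weight_ge0.
- exact: measurable_funM.
- by move=> x; rewrite mulr_ge0 ?sqnorm_ge0 ?sqr_ge0.
Qed.

End gaussian.

Theorem corollary1p6 (R : realType) (n : nat) (A : 'rV[R]_n)
    (hn : (0 < n)%N) (hA : forall i, 0 <= A 0 i) :
  let D := homdim A in
  let mu := lebesgue_rV R n in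
  (forall (f : 'rV[R]_n -> R) (gradf : 'rV[R]_n -> 'rV[R]_n),
    H10 A f gradf ->
    (\int[mu]_(x in posorthant A) (`|f x| ^+ 2 * mono x A)%:E = 1)%E ->
    (\int[mu]_(x in posorthant A)
       (`|f x| ^+ 2 * enorm x ^+ 2 * mono x A)%:E < +oo)%E ->
    ((D ^+ 2 / 4)%:E <=
       (\int[mu]_(x in posorthant A)
          (`|f x| ^+ 2 * enorm x ^+ 2 * mono x A)%:E) *
       (\int[mu]_(x in posorthant A)
          (enorm (gradf x) ^+ 2 * mono x A)%:E))%E) /\
  (let f := gaussian_extremal A in
    [/\ H10 A f (grad f),
        (\int[mu]_(x in posorthant A) (`|f x| ^+ 2 * mono x A)%:E = 1)%E,
        (\int[mu]_(x in posorthant A)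
           (enorm x ^+ 2 * `|f x| ^+ 2 * mono x A)%:E = D%:E)%E &
        ((D ^+ 2 / 4)%:E =
           (\int[mu]_(x in posorthant A)
              (`|f x| ^+ 2 * enorm x ^+ 2 * mono x A)%:E) *
           (\int[mu]_(x in posorthant A)
              (enorm (grad f x) ^+ 2 * mono x A)%:E))%E]).
Proof.
move=> D mu.
have massE (f : 'rV[R]_n -> R) :
    (\int[mu]_(x in posorthant A) (`|f x| ^+ 2 * mono x A)%:E)%E =
    wint (posorthant_weight A) (fun x => f x ^+ 2).
  rewrite -integral_posorthant; apply: eq_integral => x _.
  by rewrite real_normK ?num_real.
have momentE (f : 'rV[R]_n -> R) :
    (\int[mu]_(x in posorthant A) (`|f x| ^+ 2 * enorm x ^+ 2 * mono x A)%:E)%E =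
    wint (posorthant_weight A) (fun x => sqnorm x * f x ^+ 2).
  rewrite -integral_posorthant; apply: eq_integral => x _.
  by rewrite real_normK ?num_real// sqr_enorm [sqnorm x * _]mulrC.
have energyE (g : 'rV[R]_n -> 'rV[R]_n) :
    (\int[mu]_(x in posorthant A) (enorm (g x) ^+ 2 * mono x A)%:E)%E =
    wint (posorthant_weight A) (fun x => sqnorm (g x)).
  by rewrite -integral_posorthant; apply: eq_integral => x _; rewrite sqr_enorm.
split=> [f g Hf|f].
  by rewrite massE momentE energyE; exact: uncertainty_H10.
have fE : f = radial (gauss_profile ((2 * Pi_const A) `^ (homdim A / 4))^-1).
  exact: gaussian_extremalE.
rewrite massE momentE energyE fE; split.
- exact: H10_gauss.
- exact: gaussian_mass.
- under eq_integral do rewrite [enorm _ ^+ 2 * _]mulrC.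
  by rewrite momentE; exact: gaussian_second_moment.
- rewrite gaussian_second_moment// gaussian_energy// -EFinM.
  by congr EFin; rewrite /D; ring.
Qed.
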